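(* The parameterized problem \textsc{One-Sided Grundy Total Domination} is $\mathsf{W[1]}$-hard.
   Context: For a graph $G$ and vertex $v$, $N(v)$ denotes the open neighborhood and $N[v]=N(v)\cup\{v\}$ the closed neighborhood. A sequence $(v_1,\dots,v_k)$ of pairwise distinct vertices of $G$ is a \emph{total dominating sequence} if for every $i\in\{1,\dots,k\}$ the set $N(v_i)\setminus\bigcup_{j=1}^{i-1}N(v_j)$ is nonempty. \textsc{One-Sided Grundy Total Domination}: Input: a bipartite graph $G$ with bipartition $V(G)=A\,\dot\cup\, B$ and $k\in\mathbb{N}$. Parameter: $k$. Question: is there a total dominating sequence of $G$ of length $k$ containing only vertices of $A$? *)

(* Defs.v *)
From mathcomp Require Import all_boot.

Set Implicit Arguments.
Unset Strict Implicit.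
Unset Printing Implicit Defensive.

(* Model of computation: WHILE programs over binary trees, in the style of    *)
(* N. Jones, "Computability and Complexity from a Programming Perspective".   *)
(* An assignment is charged the size of the value it stores, so that running  *)
(* time bounds the size of all data (no exponentially large values built by   *)
(* sharing); with this cost, WHILE programs and multitape Turing machines     *)
(* simulate each other with polynomial overhead.                              *)

Inductive tree : Type := Leaf | Cons of tree & tree.

Fixpoint tsize (t : tree) : nat :=
  if t is Cons a b then (tsize a + tsize b).+1 else 1.

Definition head_tree (t : tree) : tree := if t is Cons a _ then a else Leaf.
Definition tail_tree (t : tree) : tree := if t is Cons _ b then b else Leaf.

Inductive expr : Type :=
  | EVar of nat
  | ELeaf
  | ECons of expr & expr
  | EHead of expr
  | ETail of expr.

Inductive cmd : Type :=
  | Skip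
  | Assign of nat & expr
  | Seq of cmd & cmd
  | If of expr & cmd & cmd
  | While of expr & cmd.

Definition store : Type := nat -> tree.

Definition update (s : store) (x : nat) (v : tree) : store :=
  fun y => if y == x then v else s y.

Fixpoint eval (s : store) (e : expr) : tree :=
  match e with
  | EVar x => s x
  | ELeaf => Leaf
  | ECons e1 e2 => Cons (eval s e1) (eval s e2)
  | EHead e1 => head_tree (eval s e1)
  | ETail e1 => tail_tree (eval s e1)
  end.

Definition truthy (t : tree) : bool := if t is Cons _ _ then true else false.

(* [exec p s s' t]: started in [s], [p] halts in [s'] at cost [t]. *)
Inductive exec : cmd -> store -> store -> nat -> Prop :=
  | ExecSkip s : exec Skip s s 1
  | ExecAssign x e s :
      exec (Assign x e) s (update s x (eval s e)) (tsize (eval s e)).+1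
  | ExecSeq p q s1 s2 s3 t1 t2 :
      exec p s1 s2 t1 -> exec q s2 s3 t2 -> exec (Seq p q) s1 s3 (t1 + t2)
  | ExecIfTrue e p q s s' t :
      truthy (eval s e) -> exec p s s' t -> exec (If e p q) s s' t.+1
  | ExecIfFalse e p q s s' t :
      ~~ truthy (eval s e) -> exec q s s' t -> exec (If e p q) s s' t.+1
  | ExecWhileStop e p s :
      ~~ truthy (eval s e) -> exec (While e p) s s 1
  | ExecWhileStep e p s1 s2 s3 t1 t2 :
      truthy (eval s1 e) -> exec p s1 s2 t1 -> exec (While e p) s2 s3 t2 ->
      exec (While e p) s1 s3 (t1 + t2).+1.

Definition init_store (v : tree) : store := update (fun _ => Leaf) 0 v.

(* Input and output are both in variable 0. *)
Definition runs (p : cmd) (v w : tree) (t : nat) : Prop :=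
  exists2 s : store, exec p (init_store v) s t & s 0 = w.

Definition tree_of_nat (n : nat) : tree := iter n (Cons Leaf) Leaf.

Definition tree_of_bit (b : bool) : tree :=
  if b then Cons Leaf Leaf else Leaf.

Definition tree_of_bits (x : seq bool) : tree :=
  foldr (fun b t => Cons (tree_of_bit b) t) Leaf x.

Definition tree_of_instance (x : seq bool) (k : nat) : tree :=
  Cons (tree_of_bits x) (tree_of_nat k).

Definition computable (f : nat -> nat) : Prop :=
  exists p : cmd, forall n : nat,
    exists t : nat, runs p (tree_of_nat n) (tree_of_nat (f n)) t.

(* A parameterized problem is a subset of {0,1}^* x N, the second component   *)
(* being the parameter.                                                       *)
Definition param_problem : Type := seq bool -> nat -> Prop.

(* The running time bound is f(k) |(x,k)|^O(1); the successor only keeps it   *)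
(* positive on the empty instance.                                            *)
Definition fpt_reducible (P Q : param_problem) : Prop :=
  exists (p : cmd) (f g : nat -> nat) (c : nat),
    [/\ computable f, computable g &
      forall (x : seq bool) (k : nat),
        exists (x' : seq bool) (k' t : nat),
          [/\ runs p (tree_of_instance x k) (tree_of_instance x' k') t,
              t <= f k * (size x + k).+1 ^ c,
              k' <= g k &
              P x k <-> Q x' k']].

(* Self-delimiting binary encodings. *)
Definition enc_nat (n : nat) : seq bool := rcons (nseq n true) false.

Definition enc_seq (T : Type) (enc : T -> seq bool) (s : seq T) : seq bool :=
  rcons (flatten [seq true :: enc x | x <- s]) false.

(* Boolean circuits.  The nodes are 0, ..., nodes C - 1 in a topological      *)
(* order: first the inputs, then the gates, each gate carrying the list of    *)
(* its in-neighbours; the last node is the output.                            *)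
Inductive connective : Type := Not | And | Or.

Definition gate : Type := (connective * seq nat)%type.

Record circuit : Type := Circuit { inputs : nat; gates : seq gate }.

Definition nodes (C : circuit) : nat := inputs C + size (gates C).

Definition output (C : circuit) : nat := (nodes C).-1.

Definition node_gate (C : circuit) (v : nat) : gate :=
  nth (Not, [::]) (gates C) (v - inputs C).

Definition in_nbrs (C : circuit) (v : nat) : seq nat :=
  if v < inputs C then [::] else (node_gate C v).2.

Definition fan_in_ok (g : gate) : bool :=
  if g.1 is Not then size g.2 == 1 else 1 < size g.2.

Definition well_formed (C : circuit) : Prop :=
  0 < inputs C /\
  forall v : nat, inputs C <= v < nodes C ->
    [/\ fan_in_ok (node_gate C v), uniq (in_nbrs C v) &
        forall u : nat, u \in in_nbrs C v -> u < v].

Definition wire (C : circuit) : rel nat := fun u v => u \in in_nbrs C v.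

Definition large (C : circuit) (v : nat) : bool := 2 < size (in_nbrs C v).

(* [u :: p] is a path from an input node to the output node. *)
Definition input_output_path (C : circuit) (u : nat) (p : seq nat) : bool :=
  [&& u < inputs C, path (wire C) u p & last u p == output C].

Definition depth_at_most (d : nat) (C : circuit) : Prop :=
  forall u p, input_output_path C u p -> size p <= d.

Definition weft_at_most (t : nat) (C : circuit) : Prop :=
  forall u p, input_output_path C u p -> count (large C) (u :: p) <= t.

Definition gate_value (vals : seq bool) (g : gate) : bool :=
  match g.1 with
  | Not => ~~ nth false vals (head 0 g.2)
  | And => all (nth false vals) g.2
  | Or => has (nth false vals) g.2
  end.

Definition node_values (C : circuit) (a : seq bool) : seq bool :=
  foldl (fun vals g => rcons vals (gate_value vals g)) a (gates C).

Definition satisfies (C : circuit) (a : (inputs C).-tuple bool) : bool :=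
  nth false (node_values C a) (output C).

Definition weight (a : seq bool) : nat := count id a.

Definition enc_connective (o : connective) : seq bool :=
  match o with Not => enc_nat 0 | And => enc_nat 1 | Or => enc_nat 2 end.

Definition enc_gate (g : gate) : seq bool :=
  enc_connective g.1 ++ enc_seq enc_nat g.2.

Definition enc_circuit (C : circuit) : seq bool :=
  enc_nat (inputs C) ++ enc_seq enc_gate (gates C).

(* Weighted Circuit Satisfiability on circuits of weft at most [t] and depth  *)
(* at most [d], parameterized by the weight of the assignment.                *)
Definition weighted_circuit_sat (t d : nat) : param_problem :=
  fun x k => exists C : circuit,
    [/\ well_formed C, weft_at_most t C, depth_at_most d C,
        x = enc_circuit C &
        exists2 a : (inputs C).-tuple bool, weight a = k & satisfies a].

Definition in_W (t : nat) (P : param_problem) : Prop :=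
  exists2 d : nat, 0 < d & fpt_reducible P (weighted_circuit_sat t d).

Definition W_hard (t : nat) (Q : param_problem) : Prop :=
  forall P : param_problem, in_W t P -> fpt_reducible P Q.

Definition nbhd (T : finType) (e : rel T) (v : T) : {set T} := [set u | e v u].

Definition total_dominating_sequence (T : finType) (e : rel T) (k : nat)
    (s : k.-tuple T) : Prop :=
  uniq s /\
  forall i : 'I_k,
    nbhd e (tnth s i) :\: \bigcup_(j < k | j < i) nbhd e (tnth s j) != set0.

(* [e] is the adjacency relation of a graph bipartite with sides A and ~: A;  *)
(* irreflexivity follows from the second condition.                           *)
Definition bipartite_graph (T : finType) (e : rel T) (A : {set T}) : Prop :=
  symmetric e /\ forall u v, e u v -> (u \in A) != (v \in A).

(* Number of vertices in unary, membership vector of A, adjacency matrix. *)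
Definition enc_bipartite (n : nat) (e : rel 'I_n) (A : {set 'I_n}) : seq bool :=
  enc_nat n ++ [seq u \in A | u <- enum 'I_n]
            ++ [seq e u v | u <- enum 'I_n, v <- enum 'I_n].

Definition one_sided_grundy_total_domination : param_problem :=
  fun x k => exists (n : nat) (e : rel 'I_n) (A : {set 'I_n}),
    [/\ bipartite_graph e A, x = enc_bipartite e A &
        exists2 s : k.-tuple 'I_n,
          total_dominating_sequence e s & {subset s <= A}].

(* Main.v *)
(* A circuit of weft 1 and depth d is turned into a disjunctive normal form over
   input literals and "universal" conditions (all inputs of a given large gate
   have value b); conjunctions have length at most 2^d, and their number is
   polynomial for fixed d.  The negation of a universal condition has such a
   normal form consisting of literals only, so that an assignment S satisfies
   the circuit iff for some disjunct none of polynomially many conjunctions of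
   at most q = 2^d literals holds in S.

   Write S as x_1 < ... < x_k, with x_0 and x_(k+1) the end points.  Each input
   lies in one gap [x_i, x_(i+1)), and its value is whether it equals x_i.  So
   S satisfies the circuit iff, for every q-tuple of gap indices, no bad
   conjunction is located and true in the corresponding gaps; this only
   involves the disjunct and 2q of the x_i.  We have (k+1)^q colours (the
   q-tuples) and for each of them a polynomial list of items (a disjunct with
   q pairs of positions passing the test), and ask for one item of each
   colour, such that they agree on the variables they have in common.

   For this selection problem, take M copies of each item on both sides, and
   join (t, z) and (t', y) if they have the same colour and t = t', or if z and y
   conflict on some variable.  Pairs (v_i, private neighbour of v_i) of the
   first kind are distinct in (t, colour).  For each variable there are at most two
   pairs in conflict on it: the non-edges between v_i and later private
   neighbours force a common value.  With m variables and M > 2m, a sequence of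
   length M * #colours thus has for every colour a pair without conflict, and
   by the non-edges again these items are compatible. *)
From mathcomp Require Import all_boot zify.
Require Import Defs.

Set Implicit Arguments.
Unset Strict Implicit.
Unset Printing Implicit Defensive.

(** * Codes of data as trees, and polynomial bounds in their size *)

Class codable (A : Type) := code : A -> tree.
Arguments code {A _} x.

#[global] Instance codable_unit : codable unit := fun=> Leaf.
#[global] Instance codable_bool : codable bool := tree_of_bit.
#[global] Instance codable_nat : codable nat := tree_of_nat.
#[global] Instance codable_prod A B (_ : codable A) (_ : codable B) :
  codable (A * B) := fun x => Cons (code x.1) (code x.2).
(** With these instances [tree_of_bits] and [tree_of_instance] are, up to conversion, the codes of
    [seq bool] and [seq bool * nat], so programs for typed functions run directly on problem
    instances. *)
#[global] Instance codable_seq A (_ : codable A) : codable (seq A) :=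
  foldr (fun x t => Cons (code x) t) Leaf.

Definition csize A {cA : codable A} (x : A) : nat := tsize (code x).

Lemma csize_pair A B {cA : codable A} {cB : codable B} (x : A) (y : B) :
  csize (x, y) = (csize x + csize y).+1.
Proof. by []. Qed.

Lemma csize_cons A {cA : codable A} (x : A) s :
  csize (x :: s) = (csize x + csize s).+1.
Proof. by []. Qed.

Lemma csize_nil A {cA : codable A} : csize ([::] : seq A) = 1.
Proof. by []. Qed.

Lemma csize_bool (b : bool) : csize b <= 3.
Proof. by case: b. Qed.

Lemma csize_nat n : csize n = n.*2.+1.
Proof. by rewrite /csize /code /codable_nat; elim: n => //= n ->; lia. Qed.

Lemma size_csize A {cA : codable A} (s : seq A) : size s <= csize s.
Proof. by elim: s => //= x s; rewrite csize_cons; lia. Qed.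

Lemma csize_seqE A {cA : codable A} (s : seq A) :
  csize s = (\sum_(x <- s) (csize x).+1).+1.
Proof.
elim: s => [|x s IH]; first by rewrite big_nil.
by rewrite csize_cons big_cons IH; lia.
Qed.

(** The base is always at least 2, so that raising the exponent absorbs constants and sums. *)
Definition polybounded A {cA : codable A} (h : A -> nat) : Prop :=
  exists c, forall x, h x <= (csize x).+2 ^ c.

Section Polybounded.

Variables (A : Type) (cA : codable A).
Implicit Types h : A -> nat.

Lemma pb_le h h' : (forall x, h x <= h' x) -> polybounded h' -> polybounded h.
Proof. by move=> le_hh' [c Hc]; exists c => x; apply: leq_trans (Hc x). Qed.

Lemma pb_const n : polybounded (fun _ : A => n).
Proof.
exists n => x; apply: leq_trans (ltnW (ltn_expl n (ltnSn 1))) _.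
by case: n => // n; rewrite leq_exp2r.
Qed.

Lemma pb_csize : polybounded (fun x : A => csize x).
Proof. by exists 1 => x; rewrite expn1; lia. Qed.

Lemma pb_mul h h' :
  polybounded h -> polybounded h' -> polybounded (fun x => h x * h' x).
Proof.
move=> [c Hc] [c' Hc']; exists (c + c') => x.
by rewrite expnD leq_mul.
Qed.

Lemma pb_add h h' :
  polybounded h -> polybounded h' -> polybounded (fun x => h x + h' x).
Proof.
move=> [c Hc] [c' Hc']; exists (c + c').+1 => x.
have le_c: (csize x).+2 ^ c <= (csize x).+2 ^ (c + c').
  by rewrite leq_exp2l ?leq_addr.
have le_c': (csize x).+2 ^ c' <= (csize x).+2 ^ (c + c').
  by rewrite leq_exp2l ?leq_addl.
have := Hc x; have := Hc' x; rewrite expnS.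
move: (_ ^ (c + c')) le_c le_c' => N; nia.
Qed.

Lemma pb_S h : polybounded h -> polybounded (fun x => (h x).+1).
Proof.
move=> hh; apply: (pb_le _ (pb_add hh (pb_const 1))) => x; lia.
Qed.

Lemma pb_exp h c : polybounded h -> polybounded (fun x => h x ^ c).
Proof.
move=> hh; elim: c => [|c IH]; first exact: pb_const 1.
by apply: (pb_le _ (pb_mul hh IH)) => x; rewrite expnS.
Qed.

Lemma pb_comp B (cB : codable B) (f : A -> B) (h : B -> nat) :
  polybounded (fun x => csize (f x)) -> polybounded h ->
  polybounded (fun x => h (f x)).
Proof.
move=> pf [c Hc]; apply: pb_le (pb_exp c (pb_S (pb_S pf))) => x; exact: Hc.
Qed.

End Polybounded.

(** * Polynomial-time functions *)

(** An assignment costs more than the size of the value it stores. Bounds on running time thereby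
    become bounds on output size. *)
Lemma exec_size p s s' t y :
  exec p s s' t -> tsize (s' y) <= tsize (s y) + t.
Proof.
elim=> //= *; try lia.
by rewrite /update; case: eqP => _; lia.
Qed.

(* The program for [f] is parametrized by the variable [b] holding argument and
   result: it leaves the variables below [b] alone and does not assume anything
   about those above, so that programs can be composed without renaming. *)
Definition polytime A B {cA : codable A} {cB : codable B} (f : A -> B) : Prop :=
  exists (p : nat -> cmd) (h : A -> nat), polybounded h /\
    forall b s x, s b = code x -> exists s' t,
      [/\ exec (p b) s s' t, s' b = code (f x),
          forall y, y < b -> s' y = s y & t <= h x].

Section Polytime.

Variables (A : Type) (cA : codable A).

(** By [exec_size] the result exceeds the argument by at most the running time. This bound on
    intermediate results is what makes composition polynomial. *)
Lemma pt_csize B (cB : codable B) (f : A -> B) :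
  polytime f -> polybounded (fun x => csize (f x)).
Proof.
move=> [p [h [ph Hp]]].
apply: (pb_le _ (pb_add (pb_csize _) ph)) => x.
have [s' [t [Hex r _ le_t]]] := Hp 0 (fun=> code x) x erefl.
rewrite {1}/csize -r; by apply: leq_trans (exec_size 0 Hex) _; rewrite leq_add2l.
Qed.

(** Programs only see codes, so functions into different types may share a program: a nonempty list
    is a pair, a number is a list of units. *)
Lemma pt_cast B C (cB : codable B) (cC : codable C) (f : A -> B) (g : A -> C) :
  (forall x, code (f x) = code (g x)) -> polytime g -> polytime f.
Proof.
move=> fg [p [h [ph Hp]]]; exists p, h; split=> // b s x /Hp.
by rewrite fg.
Qed.

Lemma pt_ext B (cB : codable B) (f g : A -> B) :
  f =1 g -> polytime g -> polytime f.
Proof. by move=> fg; apply: pt_cast => x; rewrite fg. Qed.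

Lemma pt_expr B (cB : codable B) (e : nat -> expr) (f : A -> B) :
  polybounded (fun x => csize (f x)) ->
  (forall b s x, s b = code x -> eval s (e b) = code (f x)) -> polytime f.
Proof.
move=> pf ef; exists (fun b => Assign b (e b)), (fun x => (csize (f x)).+1).
split=> [|b s x sx]; first exact: pb_S.
have exE := ExecAssign b (e b) s; rewrite (ef _ _ _ sx) in exE.
do 2!eexists; split; [exact: exE | | |].
- by rewrite /update eqxx.
- by move=> y yb; rewrite /update ltn_eqF.
- by [].
Qed.

Lemma pt_id : polytime (fun x : A => x).
Proof. by apply: (@pt_expr _ _ EVar); first exact: pb_csize. Qed.

Lemma pt_const B (cB : codable B) (y : B) : polytime (fun _ : A => y).
Proof.
pose fix quote t := if t is Cons a b then ECons (quote a) (quote b) else ELeaf.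
apply: (@pt_expr _ _ (fun=> quote (code y))) => [|b s x _]; first exact: pb_const.
by elim: (code y) => //= t1 -> t2 ->.
Qed.

Lemma pt_comp B C (cB : codable B) (cC : codable C) (g : B -> C) (f : A -> B) :
  polytime g -> polytime f -> polytime (fun x => g (f x)).
Proof.
move=> pg pf; have sf := pt_csize pf; case: pg pf => [p [h [ph Hp]]] [q [k [qk Hq]]].
exists (fun b => Seq (q b) (p b)), (fun x => k x + h (f x)); split.
  by apply: pb_add => //; apply: pb_comp ph.
move=> b s x /Hq[s1 [t1 [ex1 r1 pr1 le1]]].
have [s2 [t2 [ex2 r2 pr2 le2]]] := Hp _ _ _ r1.
exists s2, (t1 + t2); split=> //; first exact: ExecSeq ex1 ex2.
- by move=> y yb; rewrite pr2 // pr1.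
- exact: leq_add.
Qed.

End Polytime.

Lemma update_eq s x v : update s x v x = v.
Proof. by rewrite /update eqxx. Qed.

Lemma update_neq s x v y : y != x -> update s x v y = s y.
Proof. by rewrite /update => /negbTE->. Qed.

Section PolytimeConstructions.

Variables (A : Type) (cA : codable A).

(** Calling convention for subprograms: the argument is copied to the fresh variable [b + i] and the
    program runs there, so everything below [b + i], including the argument itself, survives for
    later calls. *)
Lemma exec_call B (cB : codable B) (f : A -> B) : polytime f ->
  exists (p : nat -> cmd) (h : A -> nat), polybounded h /\
    forall b i s x, 0 < i -> s b = code x -> exists s' t,
      [/\ exec (Seq (Assign (b + i) (EVar b)) (p (b + i))) s s' t,
          s' (b + i) = code (f x),
          forall y, y < b + i -> s' y = s y & t <= h x].
Proof.
move=> [p [h [ph Hp]]]; exists p, (fun x => (csize x).+1 + h x); split.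
  by apply: pb_add ph; apply/pb_S/pb_csize.
move=> b i s x i_gt0 sx.
have [|s' [t [ex r pr le]]] := Hp (b + i) (update s (b + i) (s b)) x.
  by rewrite update_eq.
exists s', ((csize x).+1 + t); split=> //.
- by apply: ExecSeq ex; rewrite /csize -sx; apply: ExecAssign.
- by move=> y yb; rewrite pr // update_neq // ltn_eqF.
- by rewrite leq_add2l.
Qed.

Lemma pt_pair B C (cB : codable B) (cC : codable C) (f : A -> B) (g : A -> C) :
  polytime f -> polytime g -> polytime (fun x => (f x, g x)).
Proof.
move=> pf pg; have sf := pt_csize pf; have sg := pt_csize pg.
have [p [h [ph Hp]]] := exec_call pf; have [q [k [pk Hq]]] := exec_call pg.
exists (fun b => Seq (Seq (Assign (b + 1) (EVar b)) (p (b + 1)))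
                (Seq (Seq (Assign (b + 2) (EVar b)) (q (b + 2)))
                     (Assign b (ECons (EVar (b + 1)) (EVar (b + 2)))))),
  (fun x => h x + (k x + (csize (f x, g x)).+1)); split.
  by apply: pb_add => //; apply: pb_add => //; apply/pb_S/pb_S/pb_add.
move=> b s x sx.
have [s1 [t1 [ex1 r1 pr1 le1]]] := Hp b 1 s x isT sx.
have [|s2 [t2 [ex2 r2 pr2 le2]]] := Hq b 2 s1 x isT.
  by rewrite pr1 ?sx //; lia.
have ex3 := ExecAssign b (ECons (EVar (b + 1)) (EVar (b + 2))) s2.
rewrite /= r2 pr2 ?r1 in ex3; last by lia.
eexists _, _; split; first exact: ExecSeq ex1 (ExecSeq ex2 ex3).
- by rewrite update_eq.
- by move=> y yb; rewrite update_neq ?pr2 ?pr1 //; lia.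
- by rewrite leq_add // leq_add.
Qed.

Lemma pt_if B (cB : codable B) (c : A -> bool) (f g : A -> B) :
  polytime c -> polytime f -> polytime g ->
  polytime (fun x => if c x then f x else g x).
Proof.
move=> /exec_call[p [h [ph Hp]]] [q [k [pk Hq]]] [r [l [pl Hr]]].
exists (fun b => Seq (Seq (Assign (b + 1) (EVar b)) (p (b + 1)))
                (If (EVar (b + 1)) (q b) (r b))),
  (fun x => h x + (k x + l x).+1); split.
  by apply: pb_add => //; apply: pb_S; apply: pb_add.
move=> b s x sx.
have [s1 [t1 [ex1 r1 pr1 le1]]] := Hp b 1 s x isT sx.
have s1x: s1 b = code x by rewrite pr1 //; lia.
have pr1': forall y, y < b -> s1 y = s y by move=> y yb; rewrite pr1 //; lia.
case cx: (c x).
  have [s2 [t2 [ex2 r2 pr2 le2]]] := Hq _ _ _ s1x.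
  exists s2, (t1 + t2.+1); split=> //.
  - by apply: ExecSeq ex1 _; apply: ExecIfTrue ex2; rewrite /= r1 cx.
  - by move=> y yb; rewrite pr2 // pr1'.
  - lia.
have [s2 [t2 [ex2 r2 pr2 le2]]] := Hr _ _ _ s1x.
exists s2, (t1 + t2.+1); split=> //.
- by apply: ExecSeq ex1 _; apply: ExecIfFalse ex2; rewrite /= r1 cx.
- by move=> y yb; rewrite pr2 // pr1'.
- lia.
Qed.

(* The growth of the accumulator has to be bounded separately: iterating
   a polynomial-time step may build exponentially large values. *)
Lemma pt_foldl B C (cB : codable B) (cC : codable C) (l : A -> seq C)
    (a : A -> B) (step : A -> B -> C -> B) (h : A -> nat) :
  polybounded h ->
  (forall x i, csize (foldl (step x) (a x) (take i (l x))) <= h x) ->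
  polytime l -> polytime a ->
  polytime (fun y : A * (B * C) => step y.1 y.2.1 y.2.2) ->
  polytime (fun x => foldl (step x) (a x) (l x)).
Proof.
move=> pbh Hh ptl pta pts.
have sl := pt_csize ptl.
case/exec_call: ptl => p [hp [php Hp]]; case/exec_call: pta => q [hq [phq Hq]].
case: pts => r [hr [[c Hc] Hr]].
(* [N x] bounds every value that the assignments of the loop store; the 2 accounts for the two
   pairings in the triple passed to [r]. *)
pose (N := fun x : A => csize x + h x + csize (l x) + 2).
have pbN: polybounded N.
  by apply: pb_add; [apply: pb_add => //; apply: pb_add => //; apply: pb_csize|
                     apply: pb_const].
(* Layout: [b] holds the argument, [b + 1] the rest of the list, [b + 2] the accumulator, and
   [b + 3] the argument and result of the step. *)
pose body b := Seq (Assign (b + 3)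
    (ECons (EVar b) (ECons (EVar (b + 2)) (EHead (EVar (b + 1))))))
  (Seq (r (b + 3)) (Seq (Assign (b + 2) (EVar (b + 3)))
                        (Assign (b + 1) (ETail (EVar (b + 1)))))).
(* Cost of one round: three assignments, one run of [r], and the test of the loop. *)
pose (W := fun x : A =>
  ((N x).+1 + ((N x).+2 ^ c + ((N x).+1 + (N x).+1))).+1).
exists (fun b => Seq (Seq (Assign (b + 1) (EVar b)) (p (b + 1)))
  (Seq (Seq (Assign (b + 2) (EVar b)) (q (b + 2)))
  (Seq (While (EVar (b + 1)) (body b)) (Assign b (EVar (b + 2)))))),
  (fun x => hp x + (hq x + ((csize (l x) * W x).+1 + (N x).+1))); split.
  apply: pb_add => //; apply: pb_add => //; apply: pb_add; last exact: pb_S.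
  apply: pb_S; apply: pb_mul => //; apply: pb_S; apply: pb_add; first exact: pb_S.
  apply: pb_add; first by apply: pb_exp; do 2!apply: pb_S.
  by apply: pb_add; apply: pb_S.
move=> b s x sx.
have [s1 [t1 [ex1 r1 pr1 le1]]] := Hp b 1 s x isT sx.
have [|s2 [t2 [ex2 r2 pr2 le2]]] := Hq b 2 s1 x isT.
  by rewrite pr1 ?sx //; lia.
have s2l: s2 (b + 1) = code (l x) by rewrite pr2 //; lia.
have s2x: s2 b = code x by rewrite pr2 ?pr1 //; lia.
(* Loop invariant: [l1] is processed and [l2] remains. The prefix [l1] is kept because the size
   bound [Hh] speaks of prefixes of [l x]. *)
have loop: forall l2 l1 s, l x = l1 ++ l2 -> s b = code x ->
    s (b + 1) = code l2 -> s (b + 2) = code (foldl (step x) (a x) l1) ->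
  exists s' t, [/\ exec (While (EVar (b + 1)) (body b)) s s' t,
    s' (b + 2) = code (foldl (step x) (a x) (l x)),
    forall y, y < b -> s' y = s y & t <= (size l2 * W x).+1].
  elim=> [|z l2 IH] l1 u lE ux ul ua.
    exists u, 1; split=> //; first by apply: ExecWhileStop; rewrite /= ul.
    by rewrite lE cats0.
  have Na: csize (foldl (step x) (a x) l1) <= h x.
    by have := Hh x (size l1); rewrite lE take_size_cat.
  have sizel: csize l2 + csize z < csize (l x).
    have: csize (z :: l2) <= csize (l x).
      by rewrite lE !csize_seqE big_cat /=; lia.
    by rewrite csize_cons; lia.
  have Na': csize (foldl (step x) (a x) (rcons l1 z)) <= h x.
    have := Hh x (size l1).+1.
    by rewrite lE take_cat ltnNge leqnSn subSnn /= take0 cats1.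
  set v := foldl _ _ l1 in ua Na.
  have e3 := ExecAssign (b + 3)
    (ECons (EVar b) (ECons (EVar (b + 2)) (EHead (EVar (b + 1))))) u.
  have ev: eval u (ECons (EVar b) (ECons (EVar (b + 2)) (EHead (EVar (b + 1)))))
    = code (x, (v, z)) by rewrite /= ux ua ul.
  rewrite ev in e3; set u3 := update _ _ _ in e3.
  have [|u4 [t4 [e4 r4 pr4 le4]]] := Hr (b + 3) u3 (x, (v, z)).
    by rewrite /u3 update_eq.
  have pr4' y: y < b + 3 -> u4 y = u y.
    by move=> yb; rewrite pr4 // /u3 update_neq // ltn_eqF.
  have e5 := ExecAssign (b + 2) (EVar (b + 3)) u4.
  rewrite /= r4 /= in e5; set u5 := update _ _ _ in e5.
  have e6 := ExecAssign (b + 1) (ETail (EVar (b + 1))) u5.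
  have ev6: eval u5 (ETail (EVar (b + 1))) = code l2.
    by rewrite /= /u5 update_neq ?pr4' ?ul //; lia.
  rewrite ev6 in e6; set u6 := update _ _ _ in e6.
  have [||||u7 [t7 [e7 r7 pr7 le7]]] := IH (rcons l1 z) u6.
  - by rewrite lE cat_rcons.
  - by rewrite /u6 /u5 !update_neq ?pr4' //; lia.
  - by rewrite /u6 update_eq.
  - by rewrite /u6 update_neq ?/u5 ?update_eq ?foldl_rcons //; lia.
  exists u7; eexists; split.
  - apply: ExecWhileStep e7; first by rewrite /= ul.
    exact: ExecSeq e3 (ExecSeq e4 (ExecSeq e5 e6)).
  - by [].
  - move=> y yb; rewrite pr7 // /u6 /u5 !update_neq ?pr4' //; lia.
  - have e1: tsize (code (x, (v, z))) <= N x.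
      by rewrite -/(csize _) !csize_pair /N; lia.
    have e2: tsize (code (step x v z)) <= N x.
      rewrite foldl_rcons -/v in Na'; rewrite /N; move: Na'; rewrite /csize; lia.
    have e8: tsize (code l2) <= N x by rewrite /N -/(csize _); lia.
    have e9: t4 <= (N x).+2 ^ c.
      apply: leq_trans le4 _; apply: leq_trans (Hc _) _.
      by case: (c) => // c'; rewrite leq_exp2r.
    have e10: (tsize (code (x, (v, z)))).+1 + (t4 + ((tsize (code (step x v z))).+1 + (tsize (code l2)).+1)) < W x.
      by rewrite /W ltnS; repeat (apply: leq_add => //).
    move: e10 le7; rewrite /= mulSn; move: (_ + (t4 + _)) (size l2 * W x) => T1 T2.
    lia.
have [s3 [t3 [ex3 r3 pr3 le3]]] := loop (l x) [::] s2 erefl s2x s2l r2.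
have ex4 := ExecAssign b (EVar (b + 2)) s3; rewrite /= r3 in ex4.
eexists _, _; split; first exact: ExecSeq ex1 (ExecSeq ex2 (ExecSeq ex3 ex4)).
- by rewrite update_eq.
- by move=> y yb; rewrite update_neq ?pr3 ?pr2 ?pr1 //; lia.
- apply: leq_add => //; apply: leq_add => //; apply: leq_add.
    apply: leq_trans le3 _; rewrite ltnS leq_mul2r size_csize orbT //.
  have := Hh x (size (l x)); rewrite take_size /N -/(csize _); lia.
Qed.

End PolytimeConstructions.

Section PolytimeBasics.

Variables (A : Type) (cA : codable A).
Implicit Types B C : Type.

Lemma pt_fst B C (cB : codable B) (cC : codable C) (f : A -> B * C) :
  polytime f -> polytime (fun x => (f x).1).
Proof.
apply: (@pt_comp _ _ _ _ _ _ (fun y => y.1)).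
apply: (@pt_expr _ _ _ _ (fun b => EHead (EVar b))) => [|b s [y z] /= -> //].
by apply: pb_le (@pb_csize _ _) => -[y z]; rewrite csize_pair /=; lia.
Qed.

Lemma pt_snd B C (cB : codable B) (cC : codable C) (f : A -> B * C) :
  polytime f -> polytime (fun x => (f x).2).
Proof.
apply: (@pt_comp _ _ _ _ _ _ (fun y => y.2)).
apply: (@pt_expr _ _ _ _ (fun b => ETail (EVar b))) => [|b s [y z] /= -> //].
by apply: pb_le (@pb_csize _ _) => -[y z]; rewrite csize_pair /=; lia.
Qed.

Lemma pt_app2 B C D (cB : codable B) (cC : codable C) (cD : codable D)
    (g : B -> C -> D) (f1 : A -> B) (f2 : A -> C) :
  polytime (fun y : B * C => g y.1 y.2) -> polytime f1 -> polytime f2 ->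
  polytime (fun x => g (f1 x) (f2 x)).
Proof. by move=> pg p1 p2; apply: (pt_comp pg (pt_pair p1 p2)). Qed.

Lemma pt_cons B (cB : codable B) (f : A -> B) (g : A -> seq B) :
  polytime f -> polytime g -> polytime (fun x => f x :: g x).
Proof.
by move=> pf pg; apply: (@pt_cast _ _ _ _ _ _ _ (fun x => (f x, g x))) (pt_pair pf pg).
Qed.

Lemma pt_behead B (cB : codable B) (f : A -> seq B) :
  polytime f -> polytime (fun x => behead (f x)).
Proof.
apply: (@pt_comp _ _ _ _ _ _ behead).
apply: (@pt_expr _ _ _ _ (fun b => ETail (EVar b))) => [|b s [|y z] /= -> //].
apply: pb_le (@pb_csize _ _) => -[|y z] //=; rewrite csize_cons; lia.
Qed.

(** If a step only adds an amount independent of the accumulator, the growth is at most the number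
    of entries times a uniform bound [K x] on these amounts. *)
Lemma pt_foldl_add B C (cB : codable B) (cC : codable C) (l : A -> seq C)
    (a : A -> B) (step : A -> B -> C -> B) (h : A * C -> nat) :
  polybounded h ->
  (forall x y z, csize (step x y z) <= csize y + h (x, z)) ->
  polytime l -> polytime a ->
  polytime (fun y : A * (B * C) => step y.1 y.2.1 y.2.2) ->
  polytime (fun x => foldl (step x) (a x) (l x)).
Proof.
move=> [c Hc] Hh ptl pta pts.
pose (K := fun x : A => (csize x + csize (l x) + 3) ^ c).
apply: (@pt_foldl _ _ _ _ _ _ l a step
          (fun x => csize (a x) + csize (l x) * K x)) => // [|x i].
  apply: pb_add; first exact: pt_csize.
  apply: pb_mul; first exact: pt_csize.
  apply: pb_exp; apply: pb_add; last exact: pb_const.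
  by apply: pb_add; [apply: pb_csize | apply: pt_csize].
have takeS: csize (take i (l x)) <= csize (l x).
  by rewrite -{2}(cat_take_drop i (l x)) !csize_seqE big_cat /=; lia.
have: csize (foldl (step x) (a x) (take i (l x)))
      <= csize (a x) + size (take i (l x)) * K x; last first.
  move=> le; apply: leq_trans le _; rewrite leq_add2l leq_mul2r.
  by apply/orP; right; exact: leq_trans (size_csize (take i (l x))) takeS.
elim: (take i _) (a x) takeS => [|z s IH] y /= le_s; first by lia.
rewrite csize_cons in le_s.
apply: leq_trans (IH _ _) _; first by lia.
have := Hh x y z; have: h (x, z) <= K x; last by lia.
apply: leq_trans (Hc _) _; rewrite csize_pair /K.
by case: (c) => // c'; rewrite leq_exp2r //; lia.
Qed.

End PolytimeBasics.

Lemma pb_csize_snd B C (cB : codable B) (cC : codable C) :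
  polybounded (fun y : B * C => csize y.2).
Proof. by apply: pt_csize; apply: pt_snd; apply: pt_id. Qed.

Ltac pt_proj := cbv beta; lazymatch goal with
  | |- polytime (fun x => x) => exact (pt_id _)
  | |- polytime fst => exact (pt_fst (pt_id _))
  | |- polytime snd => exact (pt_snd (pt_id _))
  | |- polytime (fun x => fst (@?f x)) => refine (@pt_fst _ _ _ _ _ _ f _); pt_proj
  | |- polytime (fun x => snd (@?f x)) => refine (@pt_snd _ _ _ _ _ _ f _); pt_proj
  | |- polytime (fun _ => ?y) => exact (pt_const _ _ y)
  end.

(** * Polynomial-time operations on lists, booleans and numbers *)

Lemma pt_catrev A (cA : codable A) B (cB : codable B) (f g : A -> seq B) :
  polytime f -> polytime g -> polytime (fun x => catrev (f x) (g x)).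
Proof.
move=> pf pg.
apply: (@pt_ext _ _ _ _ _ (fun x => foldl (fun s y => y :: s) (g x) (f x))).
  by move=> x; elim: (f x) (g x) => //= y s IH t.
apply: (@pt_foldl_add _ _ _ _ _ _ f g (fun _ s y => y :: s)
          (fun y => (csize y.2).+1)) => //.
- by apply: pb_S; apply: pb_csize_snd.
- by move=> x y z; rewrite csize_cons /=; lia.
- by apply: pt_cons; pt_proj.
Qed.

Lemma pt_rev A (cA : codable A) B (cB : codable B) (f : A -> seq B) :
  polytime f -> polytime (fun x => rev (f x)).
Proof. by move=> pf; apply: pt_catrev => //; apply: pt_const. Qed.

Lemma pt_cat A (cA : codable A) B (cB : codable B) (f g : A -> seq B) :
  polytime f -> polytime g -> polytime (fun x => f x ++ g x).
Proof.
move=> pf pg; apply: (@pt_ext _ _ _ _ _ (fun x => catrev (rev (f x)) (g x))).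
  by move=> x; rewrite catrevE revK.
by apply: pt_catrev => //; apply: pt_rev.
Qed.

Lemma pt_map A (cA : codable A) B C (cB : codable B) (cC : codable C) (f : A -> B -> C)
    (l : A -> seq B) :
  polytime (fun y : A * B => f y.1 y.2) -> polytime l ->
  polytime (fun x => [seq f x y | y <- l x]).
Proof.
move=> pf pl.
apply: (@pt_ext _ _ _ _ _
  (fun x => rev (foldl (fun s y => f x y :: s) [::] (l x)))).
  move=> x; apply: (canRL revK); rewrite -[LHS]cats0.
  by elim: (l x) [::] => //= y s IH t; rewrite -IH rev_cons cat_rcons.
apply: pt_rev; apply: (@pt_foldl_add _ _ _ _ _ _ l (fun=> [::])
  (fun x s y => f x y :: s) (fun y => (csize (f y.1 y.2)).+1)) => //.
- by apply: pb_S; apply: pt_csize.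
- by move=> x y z; rewrite csize_cons /=; lia.
- exact: pt_const.
- apply: pt_cons; last by pt_proj.
  by apply: (@pt_app2 _ _ _ _ _ _ _ _ f) => //; pt_proj.
Qed.

Lemma csize_catrev B {cB : codable B} (s t : seq B) :
  csize (catrev s t) < csize s + csize t.
Proof.
rewrite !csize_seqE; elim: s t => [|y s IH] t /=; first by rewrite big_nil; lia.
by apply: leq_trans (IH _) _; rewrite !big_cons; lia.
Qed.

Lemma pt_flatten A (cA : codable A) B (cB : codable B) (f : A -> seq (seq B)) :
  polytime f -> polytime (fun x => flatten (f x)).
Proof.
move=> pf.
apply: (@pt_ext _ _ _ _ _
  (fun x => rev (foldl (fun s t => catrev t s) [::] (f x)))).
  move=> x; apply: (canRL revK); rewrite -[LHS]cats0.
  by elim: (f x) [::] => //= y s IH t; rewrite -IH rev_cat -catA catrevE.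
apply: pt_rev; apply: (@pt_foldl_add _ _ _ _ _ _ f (fun=> [::])
  (fun x s t => catrev t s) (fun y => csize y.2)) => //.
- exact: pb_csize_snd.
- by move=> x s t; rewrite addnC; apply: ltnW (csize_catrev t s).
- exact: pt_const.
- by apply: pt_catrev; pt_proj.
Qed.

Lemma pt_foldl_bool A (cA : codable A) B (cB : codable B) (f : A -> seq B) (a : A -> bool)
    (step : A -> bool -> B -> bool) :
  polytime f -> polytime a ->
  polytime (fun y : A * (bool * B) => step y.1 y.2.1 y.2.2) ->
  polytime (fun x => foldl (step x) (a x) (f x)).
Proof.
move=> pf pa ps; apply: (@pt_foldl_add _ _ _ _ _ _ _ _ _ (fun=> 3)) => //.
  exact: pb_const.
by move=> x b y; apply: leq_trans (csize_bool _) (leq_addl _ _).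
Qed.

Lemma pt_andb A (cA : codable A) (f g : A -> bool) :
  polytime f -> polytime g -> polytime (fun x => f x && g x).
Proof.
move=> pf pg; apply: (@pt_ext _ _ _ _ _ (fun x => if f x then g x else false)).
  by move=> x; case: (f x).
by apply: pt_if => //; apply: pt_const.
Qed.

Lemma pt_orb A (cA : codable A) (f g : A -> bool) :
  polytime f -> polytime g -> polytime (fun x => f x || g x).
Proof.
move=> pf pg; apply: (@pt_ext _ _ _ _ _ (fun x => if f x then true else g x)).
  by move=> x; case: (f x).
by apply: pt_if => //; apply: pt_const.
Qed.

Lemma pt_negb A (cA : codable A) (f : A -> bool) : polytime f -> polytime (fun x => ~~ f x).
Proof.
move=> pf; apply: (@pt_ext _ _ _ _ _ (fun x => if f x then false else true)).
  by move=> x; case: (f x).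
by apply: pt_if => //; apply: pt_const.
Qed.

Lemma pt_implyb A (cA : codable A) (f g : A -> bool) :
  polytime f -> polytime g -> polytime (fun x => f x ==> g x).
Proof.
move=> pf pg; apply: (@pt_ext _ _ _ _ _ (fun x => if f x then g x else true)).
  by move=> x; case: (f x).
by apply: pt_if => //; apply: pt_const.
Qed.

Lemma pt_eqb A (cA : codable A) (f g : A -> bool) :
  polytime f -> polytime g -> polytime (fun x => f x == g x).
Proof.
move=> pf pg; apply: (@pt_ext _ _ _ _ _ (fun x => if f x then g x else ~~ g x)).
  by move=> x; case: (f x); case: (g x).
by apply: pt_if => //; apply: pt_negb.
Qed.

(** Numbers are coded in unary, so arithmetic reduces to list processing on [seq unit]. *)
Lemma code_nseq n : code n = code (nseq n tt).
Proof. by elim: n => //= n; rewrite /code /= => ->. Qed.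

Lemma pt_nseq_unit A (cA : codable A) (f : A -> nat) :
  polytime f -> polytime (fun x => nseq (f x) tt).
Proof. by apply: pt_cast => x; rewrite code_nseq. Qed.

Lemma pt_nseq A (cA : codable A) B (cB : codable B) (f : A -> nat) (g : A -> B) :
  polytime f -> polytime g -> polytime (fun x => nseq (f x) (g x)).
Proof.
move=> pf pg.
apply: (@pt_ext _ _ _ _ _ (fun x => [seq g x | _ <- nseq (f x) tt])).
  by move=> x; rewrite map_nseq.
apply: pt_map; last exact: pt_nseq_unit.
by apply: (pt_comp pg); pt_proj.
Qed.

Lemma pt_size A (cA : codable A) B (cB : codable B) (f : A -> seq B) :
  polytime f -> polytime (fun x => size (f x)).
Proof.
move=> pf; apply: (@pt_cast _ _ _ _ _ _ _ (fun x => [seq tt | _ <- f x])).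
  by move=> x; rewrite code_nseq; congr code; elim: (f x) => //= y s ->.
by apply: pt_map => //; apply: pt_const.
Qed.

Lemma pt_S A (cA : codable A) (f : A -> nat) : polytime f -> polytime (fun x => (f x).+1).
Proof.
move=> pf; apply: (@pt_cast _ _ _ _ _ _ _ (fun x => (tt, f x))) => //.
by apply: pt_pair => //; apply: pt_const.
Qed.

Lemma pt_pred A (cA : codable A) (f : A -> nat) : polytime f -> polytime (fun x => (f x).-1).
Proof.
move=> pf; apply: (@pt_cast _ _ _ _ _ _ _ (fun x => behead (nseq (f x) tt))).
  by move=> x; rewrite code_nseq; case: (f x).
by apply: pt_behead; apply: pt_nseq_unit.
Qed.

Lemma pt_add A (cA : codable A) (f g : A -> nat) :
  polytime f -> polytime g -> polytime (fun x => f x + g x).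
Proof.
move=> pf pg.
apply: (@pt_ext _ _ _ _ _ (fun x => size (nseq (f x) tt ++ nseq (g x) tt))).
  by move=> x; rewrite size_cat !size_nseq.
by apply: pt_size; apply: pt_cat; apply: pt_nseq_unit.
Qed.

Lemma pt_mul A (cA : codable A) (f g : A -> nat) :
  polytime f -> polytime g -> polytime (fun x => f x * g x).
Proof.
move=> pf pg.
apply: (@pt_ext _ _ _ _ _
          (fun x => size (flatten (nseq (f x) (nseq (g x) tt))))).
  move=> x; rewrite size_flatten /shape map_nseq size_nseq sumn_nseq mulnC //.
by apply: pt_size; apply: pt_flatten; apply: pt_nseq => //; apply: pt_nseq_unit.
Qed.

Lemma pt_exp A (cA : codable A) (f : A -> nat) c : polytime f -> polytime (fun x => f x ^ c).
Proof.
move=> pf; elim: c => [|c IH]; first exact: pt_const.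
by apply: (@pt_ext _ _ _ _ _ (fun x => f x * f x ^ c)); [move=> x; rewrite expnS|
   apply: pt_mul].
Qed.

Lemma pt_sub A (cA : codable A) (f g : A -> nat) :
  polytime f -> polytime g -> polytime (fun x => f x - g x).
Proof.
move=> pf pg.
apply: (@pt_ext _ _ _ _ _
          (fun x => foldl (fun n _ => n.-1) (f x) (nseq (g x) tt))).
  move=> x; elim: (g x) (f x) => [|n IH] m /=; first by rewrite subn0.
  by rewrite -IH; lia.
apply: (@pt_foldl_add _ _ _ _ _ _ _ _ (fun _ n _ => n.-1) (fun=> 0)) => //.
- exact: pb_const.
- by move=> *; rewrite !csize_nat; lia.
- exact: pt_nseq_unit.
- by apply: pt_pred; pt_proj.
Qed.

Lemma pt_nilp A (cA : codable A) B (cB : codable B) (f : A -> seq B) :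
  polytime f -> polytime (fun x => nilp (f x)).
Proof.
move=> pf; apply: (@pt_ext _ _ _ _ _ (fun x => foldl (fun _ _ => false) true (f x))).
  by move=> x; case: (f x) => //= y s; rewrite /nilp /=; elim: s.
by apply: (@pt_foldl_bool _ _ _ _ f (fun=> true) (fun _ _ _ => false)) => //; apply: pt_const.
Qed.

Lemma pt_leq A (cA : codable A) (f g : A -> nat) :
  polytime f -> polytime g -> polytime (fun x => f x <= g x).
Proof.
move=> pf pg.
apply: (@pt_ext _ _ _ _ _ (fun x => nilp (nseq (f x - g x) tt))).
  by move=> x; rewrite /nilp size_nseq.
by apply: pt_nilp; apply: pt_nseq_unit; apply: pt_sub.
Qed.

Lemma pt_eqn A (cA : codable A) (f g : A -> nat) :
  polytime f -> polytime g -> polytime (fun x => f x == g x).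
Proof.
move=> pf pg.
apply: (@pt_ext _ _ _ _ _ (fun x => (f x <= g x) && (g x <= f x))).
  by move=> x; rewrite eqn_leq.
by apply: pt_andb; apply: pt_leq.
Qed.

Lemma pt_all A (cA : codable A) B (cB : codable B) (p : A -> B -> bool) (f : A -> seq B) :
  polytime (fun y : A * B => p y.1 y.2) -> polytime f ->
  polytime (fun x => all (p x) (f x)).
Proof.
move=> pp pf.
apply: (@pt_ext _ _ _ _ _ (fun x => foldl (fun b y => b && p x y) true (f x))).
  move=> x; rewrite -[all _ _]andTb; elim: (f x) true => [|y s IH] b /=.
    by rewrite andbT.
  by rewrite -IH andbA.
apply: (@pt_foldl_bool _ _ _ _ _ _ (fun x b y => b && p x y)) => //.
  exact: pt_const.
apply: pt_andb; first by pt_proj.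
by apply: (@pt_app2 _ _ _ _ _ _ _ _ p) => //; pt_proj.
Qed.

Lemma pt_has A (cA : codable A) B (cB : codable B) (p : A -> B -> bool) (f : A -> seq B) :
  polytime (fun y : A * B => p y.1 y.2) -> polytime f ->
  polytime (fun x => has (p x) (f x)).
Proof.
move=> pp pf.
apply: (@pt_ext _ _ _ _ _ (fun x => ~~ all (fun y => ~~ p x y) (f x))).
  by move=> x; rewrite -has_predC; apply: eq_has => y /=; rewrite negbK.
by apply: pt_negb; apply: pt_all => //; apply: pt_negb.
Qed.

Lemma pt_filter A (cA : codable A) B (cB : codable B) (p : A -> B -> bool) (f : A -> seq B) :
  polytime (fun y : A * B => p y.1 y.2) -> polytime f ->
  polytime (fun x => [seq y <- f x | p x y]).
Proof.
move=> pp pf; apply: (@pt_ext _ _ _ _ _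
  (fun x => flatten [seq if p x y then [:: y] else [::] | y <- f x])).
  by move=> x; elim: (f x) => //= y s ->; case: ifP.
apply: pt_flatten; apply: (@pt_map _ _ _ _ _ _
  (fun x y => if p x y then [:: y] else [::])) => //.
by apply: pt_if => //; [apply: pt_cons; pt_proj | apply: pt_const].
Qed.

Lemma pt_last A (cA : codable A) B (cB : codable B) (f : A -> seq B) (a : A -> B) :
  polytime a -> polytime f -> polytime (fun x => last (a x) (f x)).
Proof.
move=> pa pf.
apply: (@pt_ext _ _ _ _ _ (fun x => foldl (fun _ y => y) (a x) (f x))).
  by move=> x; elim: (f x) (a x) => //= y s IH.
apply: (@pt_foldl_add _ _ _ _ _ _ _ _ (fun _ _ y => y) (fun y => csize y.2)) => //.
- exact: pb_csize_snd.
- by move=> x y z /=; lia.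
- by pt_proj.
Qed.

Lemma pt_head A (cA : codable A) B (cB : codable B) (f : A -> seq B) (a : A -> B) :
  polytime a -> polytime f -> polytime (fun x => head (a x) (f x)).
Proof.
move=> pa pf; apply: (@pt_ext _ _ _ _ _ (fun x => last (a x) (rev (f x)))).
  by move=> x; case: (f x) => //= y s; rewrite rev_cons last_rcons.
by apply: pt_last => //; apply: pt_rev.
Qed.

Lemma pt_drop A (cA : codable A) B (cB : codable B) (n : A -> nat) (f : A -> seq B) :
  polytime n -> polytime f -> polytime (fun x => drop (n x) (f x)).
Proof.
move=> pn pf; apply: (@pt_ext _ _ _ _ _
  (fun x => foldl (fun s _ => behead s) (f x) (nseq (n x) tt))).
  by move=> x; elim: (n x) (f x) => [|m IH] [|y s] //=; rewrite -IH.
apply: (@pt_foldl_add _ _ _ _ _ _ _ _ (fun _ s _ => behead s) (fun=> 0)) => //.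
- exact: pb_const.
- by move=> x [|y s] z //=; rewrite csize_cons; lia.
- exact: pt_nseq_unit.
- by apply: pt_behead; pt_proj.
Qed.

Lemma pt_nth A (cA : codable A) B (cB : codable B) (a : A -> B) (f : A -> seq B) (n : A -> nat) :
  polytime a -> polytime f -> polytime n ->
  polytime (fun x => nth (a x) (f x) (n x)).
Proof.
move=> pa pf pn.
apply: (@pt_ext _ _ _ _ _ (fun x => head (a x) (drop (n x) (f x)))).
  by move=> x; rewrite -nth0 nth_drop addn0.
by apply: pt_head => //; apply: pt_drop.
Qed.

Lemma pt_rcons A (cA : codable A) B (cB : codable B) (f : A -> seq B) (g : A -> B) :
  polytime f -> polytime g -> polytime (fun x => rcons (f x) (g x)).
Proof.
move=> pf pg; apply: (@pt_ext _ _ _ _ _ (fun x => f x ++ [:: g x])).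
  by move=> x; rewrite cats1.
by apply: pt_cat => //; apply: pt_cons => //; apply: pt_const.
Qed.

(** The entry appended in a step depends on the length of the accumulator, so [pt_foldl_add] does
    not apply; instead, an explicit bound is given: at most [g x] entries, each at most
    [f x + g x]. *)
Lemma pt_iota A (cA : codable A) (f g : A -> nat) :
  polytime f -> polytime g -> polytime (fun x => iota (f x) (g x)).
Proof.
move=> pf pg.
pose step (x : A) s (_ : unit) := rcons s (f x + size s).
have stepE x n : foldl (step x) [::] (nseq n tt) = iota (f x) n.
  elim: n => // n IH; rewrite -[n.+1]addn1 nseqD foldl_cat IH /= /step.
  by rewrite size_iota iotaD cats1.
apply: (@pt_ext _ _ _ _ _ (fun x => foldl (step x) [::] (nseq (g x) tt))).
  by move=> x; rewrite stepE.
apply: (@pt_foldl _ _ _ _ _ _ _ (fun=> [::]) step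
  (fun x => (g x * ((f x + g x).*2.+2)).+1)).
- have pb_nat k : polytime k -> polybounded (fun x : A => k x).
    move=> pk; apply: pb_le (pt_csize pk) => x.
    by rewrite csize_nat; lia.
  apply: pb_S; apply: pb_mul; first exact: pb_nat.
  apply: pb_S; apply: pb_S.
  apply: (@pb_le _ _ _ (fun x => (f x + g x) + (f x + g x))) => [x|].
    by rewrite addnn.
  by apply: pb_add; apply: pb_nat; apply: pt_add.
- move=> x i; have ->: take i (nseq (g x) tt) = nseq (minn i (g x)) tt.
    by elim: i (g x) => [|i IH] [|n] //=; rewrite IH minnSS.
  rewrite stepE csize_seqE ltnS.
  have le_i: minn i (g x) <= g x by exact: geq_minr.
  apply: (@leq_trans (\sum_(y <- iota (f x) (minn i (g x))) (f x + g x).*2.+2)).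
    rewrite !big_seq; apply: leq_sum => y; rewrite mem_iota csize_nat; lia.
  by rewrite big_const_seq count_predT size_iota iter_addn_0 mulnC leq_mul2r le_i orbT.
- exact: pt_nseq_unit.
- exact: pt_const.
- apply: pt_rcons; first by pt_proj.
  apply: pt_add; last by apply: pt_size; pt_proj.
  by apply: (pt_comp pf); pt_proj.
Qed.

Lemma pt_eqseq A (cA : codable A) (B : eqType) (cB : codable B) (y0 : B) (f g : A -> seq B) :
  polytime (fun y : B * B => y.1 == y.2) -> polytime f -> polytime g ->
  polytime (fun x => f x == g x).
Proof.
move=> pB pf pg; apply: (@pt_ext _ _ _ _ _ (fun x =>
  (size (f x) == size (g x)) &&
  all (fun i => nth y0 (f x) i == nth y0 (g x) i) (iota 0 (size (f x))))).
  move=> x; apply/eqP/andP => [->|[/eqP size_fg /allP nth_fg]].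
    by split=> //; apply/allP.
  apply: (@eq_from_nth _ y0) => // i lt_i; apply/eqP/nth_fg.
  by rewrite mem_iota.
apply: pt_andb; first by apply: pt_eqn; apply: pt_size.
apply: pt_all; last by apply: pt_iota; [apply: pt_const | apply: pt_size].
apply: (@pt_app2 _ _ _ _ _ _ _ _ (fun y z : B => y == z)) => //.
  by apply: pt_nth; [apply: pt_const | apply: (pt_comp pf); pt_proj | pt_proj].
by apply: pt_nth; [apply: pt_const | apply: (pt_comp pg); pt_proj | pt_proj].
Qed.

Lemma pt_allpairs A (cA : codable A) B C D (cB : codable B) (cC : codable C) (cD : codable D)
    (h : A -> B -> C -> D) (f : A -> seq B) (g : A -> seq C) :
  polytime (fun y : A * (B * C) => h y.1 y.2.1 y.2.2) ->
  polytime f -> polytime g ->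
  polytime (fun x => [seq h x y z | y <- f x, z <- g x]).
Proof.
move=> ph pf pg; apply: pt_flatten.
apply: (@pt_map _ _ _ _ _ _ (fun x y => [seq h x y z | z <- g x])) => //.
apply: (@pt_map _ _ _ _ _ _ (fun y z => h y.1 y.2 z)).
  apply: (@pt_comp _ _ _ _ _ _ (fun y : A * (B * C) => h y.1 y.2.1 y.2.2)
           (fun z : A * B * C => (z.1.1, (z.1.2, z.2)))) => //.
  by apply: pt_pair; [pt_proj | apply: pt_pair; pt_proj].
by apply: (pt_comp pg); pt_proj.
Qed.

(** * Automation for goals of polynomial time *)

Ltac pt_user := idtac.

Ltac pt_eta := lazymatch goal with
  | |- polytime (fun _ => _) => idtac
  | |- polytime ?f => change (polytime (fun x => f x))
  | |- _ => idtac
  end.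

(** Recursion on the syntax of the function; second-order patterns keep track of the context of
    bound variables. Goals that match no rule are left to [pt_user], which is redefined as more
    functions become available. *)
Ltac pt := cbv beta; try assumption; pt_eta; lazymatch goal with
  | |- polytime (fun x => x) => exact (pt_id _)
  | |- polytime (fun _ => ?y) => exact (pt_const _ _ y)
  | |- polytime (fun x => fst (@?f x)) => refine (pt_fst (f := f) _); pt
  | |- polytime (fun x => snd (@?f x)) => refine (pt_snd (f := f) _); pt
  | |- polytime (fun x => (@?f x, @?g x)) => refine (pt_pair (f := f) (g := g) _ _); pt
  | |- polytime (fun x => @?f x :: @?g x) => refine (pt_cons (f := f) (g := g) _ _); pt
  | |- polytime (fun x => @?f x ++ @?g x) => refine (pt_cat (f := f) (g := g) _ _); pt
  | |- polytime (fun x => rev (@?f x)) => refine (pt_rev (f := f) _); pt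
  | |- polytime (fun x => behead (@?f x)) => refine (pt_behead (f := f) _); pt
  | |- polytime (fun x => flatten (map (fun y => map (@?h x y) (@?g x)) (@?f x))) =>
      refine (pt_allpairs (h := h) (f := f) (g := g) _ _ _); pt
  | |- polytime (fun x => flatten (@?f x)) => refine (pt_flatten (f := f) _); pt
  | |- polytime (fun x => map (@?f x) (@?l x)) => refine (pt_map (f := f) (l := l) _ _); pt
  | |- polytime (fun x => filter (@?f x) (@?l x)) =>
      refine (pt_filter (p := f) (f := l) _ _); pt
  | |- polytime (fun x => all (@?f x) (@?l x)) => refine (pt_all (p := f) (f := l) _ _); pt
  | |- polytime (fun x => has (@?f x) (@?l x)) => refine (pt_has (p := f) (f := l) _ _); pt
  | |- polytime (fun x => head (@?a x) (@?f x)) => refine (pt_head (f := f) (a := a) _ _); pt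
  | |- polytime (fun x => nth (@?a x) (@?f x) (@?n x)) =>
      refine (pt_nth (a := a) (f := f) (n := n) _ _ _); pt
  | |- polytime (fun x => drop (@?n x) (@?f x)) => refine (pt_drop (n := n) (f := f) _ _); pt
  | |- polytime (fun x => rcons (@?f x) (@?g x)) => refine (pt_rcons (f := f) (g := g) _ _); pt
  | |- polytime (fun x => nseq (@?f x) (@?g x)) => refine (pt_nseq (f := f) (g := g) _ _); pt
  | |- polytime (fun x => iota (@?f x) (@?g x)) => refine (pt_iota (f := f) (g := g) _ _); pt
  | |- polytime (fun x => size (@?f x)) => refine (pt_size (f := f) _); pt
  | |- polytime (fun x => nilp (@?f x)) => refine (pt_nilp (f := f) _); pt
  | |- polytime (fun x => (@?f x).+1) => refine (pt_S (f := f) _); pt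
  | |- polytime (fun x => (@?f x).-1) => refine (pt_pred (f := f) _); pt
  | |- polytime (fun x => @?f x + @?g x) => refine (pt_add (f := f) (g := g) _ _); pt
  | |- polytime (fun x => @?f x - @?g x) => refine (pt_sub (f := f) (g := g) _ _); pt
  | |- polytime (fun x => @?f x * @?g x) => refine (pt_mul (f := f) (g := g) _ _); pt
  | |- polytime (fun x => @?f x ^ ?n) => refine (pt_exp (f := f) n _); pt
  | |- polytime (fun x => @?f x <= @?g x) => refine (pt_leq (f := f) (g := g) _ _); pt
  | |- polytime (fun x => @?f x && @?g x) => refine (pt_andb (f := f) (g := g) _ _); pt
  | |- polytime (fun x => @?f x || @?g x) => refine (pt_orb (f := f) (g := g) _ _); pt
  | |- polytime (fun x => ~~ @?f x) => refine (pt_negb (f := f) _); pt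
  | |- polytime (fun x => @?f x ==> @?g x) => refine (pt_implyb (f := f) (g := g) _ _); pt
  | |- polytime (fun x => @?f x == @?g x) =>
      first [ refine (pt_eqn (f := f) (g := g) _ _)
            | refine (pt_eqb (f := f) (g := g) _ _)
            | refine (pt_eqseq (f := f) (g := g) 0 _ _ _)
            | refine (pt_eqseq (f := f) (g := g) false _ _ _) ]; pt
  | |- polytime (fun x => if _ then _ else _) => refine (pt_if _ _ _); pt
  | H : polytime ?f |- polytime (fun x => ?f (@?g x)) =>
      refine (pt_comp (g := f) (f := g) H _); pt
  | |- polytime _ => pt_user
  | |- _ => idtac
  end.

(** * Parsing circuits *)

Definition conn_nat (o : connective) : nat :=
  match o with Not => 0 | And => 1 | Or => 2 end.

Definition conn_of_nat (n : nat) : connective :=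
  if n == 0 then Not else if n == 1 then And else Or.

Lemma conn_natK : cancel conn_nat conn_of_nat.
Proof. by case. Qed.

#[global] Instance codable_connective : codable connective :=
  fun o => code (conn_nat o).

#[global] Instance codable_circuit : codable circuit :=
  fun C => code (inputs C, gates C).

Section PolytimeCircuit.

Variables (A : Type) (cA : codable A).

Lemma pt_conn_nat (f : A -> connective) :
  polytime f -> polytime (fun x => conn_nat (f x)).
Proof. exact: pt_cast. Qed.

Lemma pt_conn_of_nat (f : A -> nat) :
  polytime f -> polytime (fun x => conn_of_nat (f x)).
Proof. by move=> pf; rewrite /conn_of_nat; pt. Qed.

Lemma pt_inputs (f : A -> circuit) :
  polytime f -> polytime (fun x => inputs (f x)).
Proof.
move=> pf; apply: (pt_fst (f := fun x => (inputs (f x), gates (f x)))).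
exact: pt_cast pf.
Qed.

Lemma pt_gates (f : A -> circuit) :
  polytime f -> polytime (fun x => gates (f x)).
Proof.
move=> pf; apply: (pt_snd (f := fun x => (inputs (f x), gates (f x)))).
exact: pt_cast pf.
Qed.

Lemma pt_Circuit (f : A -> nat) (g : A -> seq gate) :
  polytime f -> polytime g -> polytime (fun x => Circuit (f x) (g x)).
Proof.
move=> pf pg; apply: (@pt_cast _ _ _ _ _ _ _ (fun x => (f x, g x))) => //.
exact: pt_pair.
Qed.

End PolytimeCircuit.

Ltac pt_user ::= lazymatch goal with
  | |- polytime (fun x => conn_nat (@?f x)) => refine (pt_conn_nat (f := f) _); pt
  | |- polytime (fun x => conn_of_nat (@?f x)) => refine (pt_conn_of_nat (f := f) _); pt
  | |- polytime (fun x => inputs (@?f x)) => refine (pt_inputs (f := f) _); pt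
  | |- polytime (fun x => gates (@?f x)) => refine (pt_gates (f := f) _); pt
  | |- polytime (fun x => Circuit (@?f x) (@?g x)) =>
      refine (pt_Circuit (f := f) (g := g) _ _); pt
  | |- _ => idtac
  end.

(* Cuts a sequence after each element satisfying [p], dropping that element;
   what follows the last such element is kept as a last piece, if nonempty. *)
Definition split T (p : pred T) (s : seq T) : seq (seq T) :=
  foldr (fun x ss => if p x then [::] :: ss
                     else (x :: head [::] ss) :: behead ss) [::] s.

Lemma split_cat T (p : pred T) s x t :
  ~~ has p s -> p x -> split p (s ++ x :: t) = s :: split p t.
Proof.
move=> + px; elim: s => [|y s IH] /=; first by rewrite px.
by case: (p y) => //= /IH ->.
Qed.

Lemma pt_split A B (cA : codable A) (cB : codable B) (p : B -> bool)
    (f : A -> seq B) :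
  polytime p -> polytime f -> polytime (fun x => split p (f x)).
Proof.
move=> pp pf; apply: (@pt_ext _ _ _ _ _ (fun x =>
  foldl (fun ss y => if p y then [::] :: ss
                     else (y :: head [::] ss) :: behead ss) [::] (rev (f x)))).
  by move=> x; rewrite foldl_rev.
apply: (@pt_foldl_add _ _ _ _ _ _ _ (fun=> [::]) (fun _ ss y =>
  if p y then [::] :: ss else (y :: head [::] ss) :: behead ss)
  (fun y => (csize y.2) + 4)) => //; [|move=> x ss y|pt|pt|].
- by apply: pb_add; [apply: pb_csize_snd | apply: pb_const].
- by case: (p y); case: ss => * /=; rewrite !csize_cons ?csize_nil; lia.
- by pt.
Qed.

(** Cutting at each [false] turns a bit string into the numbers coded in unary. The [true] that
    announces a list entry lengthens the first number of that entry by one, so that a token 0 in its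
    place marks the end of the list. *)
Definition tokens (x : seq bool) : seq nat := [seq size s | s <- split negb x].

(** After the number of inputs, each gate ends with a token 0. The empty piece due to the final 0 is
    filtered out, and the predecessors undo the shift by list markers. A string that encodes no
    circuit is parsed to some circuit as well; [valid] detects this by encoding again. *)
Definition parse (x : seq bool) : circuit :=
  Circuit (head 0 (tokens x))
    [seq (conn_of_nat (head 0 s).-1, [seq u.-1 | u <- behead s])
    | s <- [seq s <- split (fun u => u == 0) (behead (tokens x)) | ~~ nilp s]].

Lemma tokens_enc_nat n x : tokens (enc_nat n ++ x) = n :: tokens x.
Proof.
rewrite /tokens /enc_nat cat_rcons split_cat //= ?size_nseq //.
by rewrite has_nseq andbF.
Qed.

Lemma tokens_enc_seq T (enc : T -> seq bool) (tok : T -> seq nat) l x :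
  (forall y x, tokens (true :: enc y ++ x) = tok y ++ tokens x) ->
  tokens (enc_seq enc l ++ x) = flatten [seq tok y | y <- l] ++ 0 :: tokens x.
Proof.
move=> encE; rewrite /enc_seq cat_rcons; elim: l => [|y l IH] /=.
  exact: (tokens_enc_nat 0).
by rewrite -!catA encE IH.
Qed.

Lemma tokens_enc_circuit C : tokens (enc_circuit C) = inputs C ::
  flatten [seq rcons ((conn_nat g.1).+1 :: [seq u.+1 | u <- g.2]) 0 | g <- gates C]
    ++ [:: 0].
Proof.
rewrite /enc_circuit tokens_enc_nat -[enc_seq _ _]cats0; congr (_ :: _).
apply: tokens_enc_seq => -[o l] x; rewrite /enc_gate /= -catA -cat_cons.
have ->: true :: enc_connective o = enc_nat (conn_nat o).+1 by case: o.
rewrite tokens_enc_nat (tokens_enc_seq (tok := fun u => [:: u.+1])) /=.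
  by rewrite cat_rcons flatten_map1.
by move=> u y; apply: (tokens_enc_nat u.+1).
Qed.

Lemma parseK : cancel enc_circuit parse.
Proof.
move=> C; rewrite /parse tokens_enc_circuit; case: C => n gs.
pose t (g : gate) := (conn_nat g.1).+1 :: [seq u.+1 | u <- g.2].
have splitE: split (fun u => u == 0) (flatten [seq rcons (t g) 0 | g <- gs]
    ++ [:: 0]) = rcons [seq t g | g <- gs] [::].
  elim: gs => [|g gs IH] //; rewrite map_cons -[flatten (_ :: _)]/(_ ++ _).
  rewrite -catA cat_rcons split_cat //; first by rewrite IH.
  by rewrite /= has_map; apply/hasPn.
rewrite [inputs _]/= [gates _]/= [head _ _]/= [behead _]/= splitE -cats1.
rewrite filter_cat cats0; congr Circuit.
elim: gs {splitE} => [|[o l] gs IH] //=.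
by rewrite conn_natK -map_comp map_id IH.
Qed.

Lemma pt_parse : polytime parse.
Proof.
have pt_tok: polytime tokens.
  by rewrite /tokens; pt; apply: (@pt_split _ _ _ _ negb (fun x => x)); pt.
have pt_sp: polytime (fun x => split (fun u => u == 0) (behead (tokens x))).
  by apply: (@pt_split _ _ _ _ _ (fun x => behead (tokens x))); pt.
by rewrite /parse; pt.
Qed.

Lemma pt_enc_nat A (cA : codable A) (f : A -> nat) :
  polytime f -> polytime (fun x => enc_nat (f x)).
Proof. by move=> pf; rewrite /enc_nat; pt. Qed.

Lemma pt_enc_seq A B (cA : codable A) (cB : codable B) (enc : B -> seq bool)
    (f : A -> seq B) :
  polytime enc -> polytime f -> polytime (fun x => enc_seq enc (f x)).
Proof.
move=> penc pf; rewrite /enc_seq.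
by pt.
Qed.

Lemma pt_enc_circuit : polytime enc_circuit.
Proof.
have pt_nat: polytime enc_nat by apply: (pt_enc_nat (pt_id _)).
have pt_gate: polytime enc_gate.
  apply: (@pt_ext _ _ _ _ _ (fun g => enc_nat (conn_nat g.1) ++ enc_seq enc_nat g.2)).
    by case=> -[].
  have pt1: polytime (fun g : gate => enc_nat (conn_nat g.1)).
    by apply: pt_enc_nat; pt.
  have pt2: polytime (fun g : gate => enc_seq enc_nat g.2).
    by apply: pt_enc_seq => //; pt.
  by pt.
rewrite /enc_circuit.
have pt1: polytime (fun C => enc_nat (inputs C)) by apply: pt_enc_nat; pt.
have pt2: polytime (fun C => enc_seq enc_gate (gates C)).
  by apply: pt_enc_seq => //; pt.
by pt.
Qed.

(** * Circuits of bounded depth and weft *)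

Definition well_formedb (C : circuit) : bool :=
  (0 < inputs C) && all (fun v =>
    [&& fan_in_ok (node_gate C v),
        all (fun u => size [seq w <- in_nbrs C v | w == u] <= 1) (in_nbrs C v) &
        all (fun u => u < v) (in_nbrs C v)])
    (iota (inputs C) (size (gates C))).

(** Expresses [uniq] by list operations already known to take polynomial time. *)
Lemma uniq_count_le1 (T : eqType) (s : seq T) :
  all (fun x => size [seq y <- s | y == x] <= 1) s = uniq s.
Proof.
apply/allP/idP => [|us x xs]; last first.
  by rewrite size_filter (count_uniq_mem x us) xs.
elim: s => //= x s IH le1; apply/andP; split.
  have := le1 x (mem_head _ _); rewrite eqxx /= ltnS leqn0 size_eq0.
  by rewrite -[_ == _]negbK -has_filter has_pred1.
apply: IH => y ys; have := le1 y; rewrite inE ys orbT => /(_ isT) /=.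
by case: ifP => //= _ /ltnW.
Qed.

Lemma well_formedP C : reflect (well_formed C) (well_formedb C).
Proof.
apply: (iffP andP) => -[n_gt0 wf]; split=> //.
  move=> v v_node; have := allP wf v; rewrite mem_iota => /(_ v_node).
  rewrite uniq_count_le1 => /and3P[? ? /allP lt_v]; split=> // u; exact: lt_v.
apply/allP => v; rewrite mem_iota => /wf[? ? lt_v].
by rewrite uniq_count_le1; apply/and3P; split=> //; apply/allP.
Qed.

(** Checks depth and weft of all paths ending in [v] without enumerating them: [j] and [w] are the
    budgets of wires and of large gates. For fixed [j] this is a bounded nesting of list operations,
    hence polynomial. *)
Fixpoint shallow (C : circuit) (j : nat) (w : nat) (v : nat) : bool :=
  (v < inputs C) ||
  if j is j'.+1 then
    if large C v then (0 < w) && all (shallow C j' w.-1) (in_nbrs C v)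
    else all (shallow C j' w) (in_nbrs C v)
  else false.

Lemma shallowS C j w v : shallow C j.+1 w v = (v < inputs C) ||
  if large C v then (0 < w) && all (shallow C j w.-1) (in_nbrs C v)
  else all (shallow C j w) (in_nbrs C v).
Proof. by []. Qed.

Lemma in_nbrs_input C v : v < inputs C -> in_nbrs C v = [::].
Proof. by rewrite /in_nbrs => ->. Qed.

Lemma in_nbrs_gate C v : inputs C <= v -> in_nbrs C v = (node_gate C v).2.
Proof. by rewrite /in_nbrs leqNgt => /negbTE ->. Qed.

Section WellFormed.

Variables (C : circuit) (wfC : well_formed C).

Lemma in_nbrs_lt v u : v < nodes C -> u \in in_nbrs C v -> u < v.
Proof.
move=> v_node; case: (ltnP v (inputs C)) => [/in_nbrs_input-> //|v_gate].
by have [_ _] := wfC.2 v (introT andP (conj v_gate v_node)); apply.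
Qed.

Lemma in_nbrs_node v u : v < nodes C -> u \in in_nbrs C v -> u < nodes C.
Proof. by move=> vn /(in_nbrs_lt vn) /ltn_trans; apply. Qed.

Lemma in_nbrs_neq0 v : inputs C <= v < nodes C -> exists u, u \in in_nbrs C v.
Proof.
move=> v_gate; have [+ _ _] := wfC.2 v v_gate.
rewrite in_nbrs_gate; last by case/andP: v_gate.
by case: node_gate => [[] [|u us]] //= _; exists u; rewrite mem_head.
Qed.

Lemma output_node : output C < nodes C.
Proof. by rewrite /output prednK // /nodes; have := wfC.1; lia. Qed.

(** Every gate has an in-neighbour, and it is smaller, so walking backwards ends in an input. *)
Lemma path_to_node v : v < nodes C ->
  exists u p, [/\ u < inputs C, path (wire C) u p & last u p = v].
Proof.
elim/ltn_ind: v => v IH v_node; case: (ltnP v (inputs C)) => v_in.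
  by exists v, [::].
have [|u uv] := @in_nbrs_neq0 v; first by rewrite v_in.
have [||x [p [x_in pp lp]]] := IH u; try by [apply: in_nbrs_lt | apply: in_nbrs_node uv].
by exists x, (rcons p v); rewrite rcons_path last_rcons pp lp; split.
Qed.

(** A path to a gate is a path to one of its in-neighbours followed by one wire. [path_to_node]
    provides an actual path wherever a budget has to be shown positive. *)
Lemma shallowP j w v : v < nodes C ->
  (forall u p, u < inputs C -> path (wire C) u p -> last u p = v ->
     size p <= j /\ count (large C) (u :: p) <= w) <-> shallow C j w v.
Proof.
elim: j w v => [|j IH] w v v_node; rewrite [shallow _ _ _ _]/=;
  case: (ltnP v (inputs C)) => v_in; rewrite ?orTb ?orFb.
- split=> // _ u p _; case/lastP: p => [|p x]; rewrite ?last_rcons.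
    by move=> _ /= ->; rewrite /large in_nbrs_input.
  by rewrite rcons_path => /andP[_] + xv; rewrite xv /wire in_nbrs_input.
- split=> // H; have [u [p [u_in pp lp]]] := path_to_node v_node.
  have [] := H u p u_in pp lp; rewrite leqn0 size_eq0 => /eqP p0.
  by rewrite p0 /= in lp; rewrite lp ltnNge v_in in u_in.
- split=> // _ u p _; case/lastP: p => [|p x]; rewrite ?last_rcons.
    by move=> _ /= ->; rewrite /large in_nbrs_input.
  by rewrite rcons_path => /andP[_] + xv; rewrite xv /wire in_nbrs_input.
- have extend x u p : u < inputs C -> path (wire C) u p -> last u p = x ->
      x \in in_nbrs C v -> path (wire C) u (rcons p v) /\ last u (rcons p v) = v.
    by move=> u_in pp lp xv; rewrite rcons_path last_rcons pp lp.
  have countE u p : count (large C) (u :: rcons p v)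
      = count (large C) (u :: p) + large C v.
    by rewrite -rcons_cons -cats1 count_cat /= addn0.
  have childP w' x : x \in in_nbrs C v -> (forall u p, u < inputs C ->
      path (wire C) u p -> last u p = x -> count (large C) (u :: p) <= w') ->
      (forall u p, u < inputs C -> path (wire C) u p -> last u p = v ->
        size p <= j.+1) -> shallow C j w' x.
    move=> xv Hw Hj; apply/IH => [|u p u_in pp lp]; first exact: in_nbrs_node xv.
    split; last exact: Hw lp; have [pp' lp'] := extend _ _ _ u_in pp lp xv.
    by have := Hj _ _ u_in pp' lp'; rewrite size_rcons.
  split=> [H|].
    case: ifP => lv; last first.
      apply/allP => x xv; apply: childP => // [u p u_in pp lp|u p u_in pp /(H _ _ u_in pp)[]//].
      have [pp' lp'] := extend _ _ _ u_in pp lp xv.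
      by have [_] := H _ _ u_in pp' lp'; rewrite countE lv addn0.
    have w_gt0: 0 < w.
      have [u [p [u_in pp lp]]] := path_to_node v_node.
      have [_] := H _ _ u_in pp lp.
      case/lastP: p lp {pp} => [/= uv|p x]; first by rewrite uv lv; lia.
      by rewrite last_rcons => ->; rewrite countE lv; lia.
    rewrite w_gt0; apply/allP => x xv.
    apply: childP => // [u p u_in pp lp|u p u_in pp /(H _ _ u_in pp)[]//].
    have [pp' lp'] := extend _ _ _ u_in pp lp xv.
    by have [_] := H _ _ u_in pp' lp'; rewrite countE lv; lia.
  move=> H u p u_in; case/lastP: p => [_ /= uv|p x].
    by rewrite uv ltnNge v_in in u_in.
  rewrite rcons_path last_rcons => /andP[pp + xv].
  rewrite xv size_rcons countE => uv.
  have l_node := in_nbrs_node v_node uv.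
  case: (large C v) H => [/andP[w_gt0 /allP/(_ _ uv)]|/allP/(_ _ uv)].
    by move/(IH _ _ l_node)/(_ _ _ u_in pp erefl) => -[]; lia.
  by move/(IH _ _ l_node)/(_ _ _ u_in pp erefl) => -[]; lia.
Qed.

Lemma shallow_mono j w v : shallow C j w v -> shallow C j.+1 w v.
Proof.
elim: j w v => [|j IH] w v; first by rewrite /= orbF => ->.
rewrite !shallowS; case: (v < _) => //=.
case: (large C v) => [/andP[-> /allP H] /=|/allP H]; apply/allP => x /H; exact: IH.
Qed.

Lemma weft_depth_shallow t d :
  (weft_at_most t C /\ depth_at_most d C) <-> shallow C d t (output C).
Proof.
split=> [[Hw Hd]|/(shallowP _ _ output_node) H].
  apply/shallowP => [|u p u_in pp lp]; first exact: output_node.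
  by split; [apply: (Hd u)|apply: (Hw u p)]; rewrite /input_output_path u_in pp lp eqxx.
by split=> u p /and3P[u_in pp /eqP lp]; have [] := H _ _ u_in pp lp.
Qed.

End WellFormed.

(** * Values of nodes *)

Section Values.

Variables (C : circuit) (wfC : well_formed C) (a : seq bool).
Hypothesis size_a : size a = inputs C.

Let step vals g := rcons vals (gate_value vals g).

Lemma size_values gs vals : size (foldl step vals gs) = size vals + size gs.
Proof.
by elim: gs vals => [|g gs IH] vals /=; rewrite ?addn0 // IH size_rcons addSnnS.
Qed.

Lemma nth_values gs vals v : v < size vals ->
  nth false (foldl step vals gs) v = nth false vals v.
Proof.
elim: gs vals => //= g gs IH vals lt_v.
by rewrite IH ?nth_rcons ?size_rcons ?lt_v // ltnW.
Qed.

Lemma gate_value_eq vals vals' g :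
  {in g.2, nth false vals =1 nth false vals'} ->
  0 < size g.2 -> gate_value vals g = gate_value vals' g.
Proof.
case: g => -[] [|u us] //= H _; rewrite /gate_value /=.
- by rewrite H ?mem_head.
- by rewrite H ?mem_head //; congr andb; apply: eq_in_all => v vs; rewrite H ?inE ?vs ?orbT.
- by rewrite H ?mem_head //; congr orb; apply: eq_in_has => v vs; rewrite H ?inE ?vs ?orbT.
Qed.

Definition node_value v := nth false (node_values C a) v.

Lemma node_value_input v : v < inputs C -> node_value v = nth false a v.
Proof. by move=> v_in; rewrite /node_value /node_values nth_values ?size_a. Qed.

(** The gate was evaluated on the values of the nodes before [v]. Its in-neighbours are among these,
    and later gates do not change them, so the complete list of values gives the same result. *)
Lemma node_value_gate v : inputs C <= v < nodes C ->
  node_value v = gate_value (node_values C a) (node_gate C v).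
Proof.
move=> v_gate; have /andP[v_in v_node] := v_gate.
have [u0 u0v] := in_nbrs_neq0 wfC v_gate.
pose i := v - inputs C; have lt_i: i < size (gates C).
  by rewrite /i; rewrite /nodes in v_node; lia.
have valsE: node_values C a = foldl step (foldl step a (take i.+1 (gates C))) (drop i.+1 (gates C)).
  by rewrite -foldl_cat cat_take_drop.
pose vals := foldl step a (take i (gates C)).
have size_vals: size vals = v.
  by rewrite size_values size_a size_take lt_i /i; lia.
have take_i: foldl step a (take i.+1 (gates C))
    = rcons vals (gate_value vals (node_gate C v)).
  by rewrite (take_nth (Not, [::])) // foldl_rcons.
rewrite /node_value {1}valsE nth_values take_i ?size_rcons ?size_vals //.
rewrite nth_rcons size_vals ltnn eqxx.
apply: gate_value_eq => [u|]; rewrite -in_nbrs_gate //; last first.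
  by case: (in_nbrs C v) u0v.
move/(in_nbrs_lt wfC v_node) => lt_uv.
have ->: node_values C a = foldl step vals (drop i (gates C)).
  by rewrite -foldl_cat cat_take_drop.
by rewrite nth_values // size_vals.
Qed.

End Values.

(** * Disjunctive normal form above the large gates *)

(* [And] for the value [false], [Or] for [true]. *)
Definition disjunctive (o : connective) (b : bool) : bool :=
  conn_nat o == b.+1.

(* Both literals and universal conditions, that all inputs of the large gate [v]
   have value [b], are represented by [(v, b)]: the node [v] has value [b]. *)
Fixpoint dnf (C : circuit) (j : nat) (v : nat) (b : bool) :
    seq (seq (nat * bool)) :=
  if v < inputs C then [:: [:: (v, b)]] else
  if j is j'.+1 then
    if conn_nat (node_gate C v).1 == 0 then
      flatten [seq dnf C j' u (~~ b) | u <- in_nbrs C v]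
    else if disjunctive (node_gate C v).1 b then
      flatten [seq dnf C j' u b | u <- in_nbrs C v]
    else if large C v then [:: [:: (v, b)]]
    else [seq c1 ++ c2 | c1 <- dnf C j' (nth 0 (in_nbrs C v) 0) b,
                         c2 <- dnf C j' (nth 0 (in_nbrs C v) 1) b]
  else [::].

(** The gate takes the value [x.2] only if all its inputs do, and no large gate lies at or below
    these inputs, so that their normal forms consist of literals. *)
Definition universal (C : circuit) (j : nat) (x : nat * bool) : bool :=
  [&& inputs C <= x.1 < nodes C, 0 < conn_nat (node_gate C x.1).1,
      ~~ disjunctive (node_gate C x.1).1 x.2 & all (shallow C j 0) (in_nbrs C x.1)].

Lemma has_flatten (T : Type) (p : pred T) (ss : seq (seq T)) :
  has p (flatten ss) = has (has p) ss.
Proof. by elim: ss => //= s ss IH; rewrite has_cat IH. Qed.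

Lemma all_flatten (T : Type) (p : pred T) (ss : seq (seq T)) :
  all p (flatten ss) = all (all p) ss.
Proof. by elim: ss => //= s ss IH; rewrite all_cat IH. Qed.

Section Claims.

Variables (C : circuit) (wfC : well_formed C).

(** Conjunctions are only joined at small conjunctive gates, two at a time, so their length at most
    doubles per level. *)
Lemma size_dnf j v b : all (fun c => size c <= 2 ^ j) (dnf C j v b).
Proof.
elim: j v b => [|j IH] v b /=; first by case: ifP.
case: ifP => _ /=; first by rewrite expn_gt0.
have IH' u b' c : c \in dnf C j u b' -> size c <= 2 ^ j.+1.
  by move=> /(allP (IH u b')) /leq_trans; apply; rewrite leq_exp2l.
case: ifP => _; first by apply/allP => c /flatten_mapP[u _]; apply: IH'.
case: ifP => _; first by apply/allP => c /flatten_mapP[u _]; apply: IH'.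
case: ifP => _ /=; first by rewrite expn_gt0.
apply/allP => c /allpairsP[[c1 c2] [/= h1 h2 ->]].
rewrite size_cat expnS mul2n -addnn leq_add //.
  exact: (allP (IH _ _) _ h1).
exact: (allP (IH _ _) _ h2).
Qed.

Lemma shallow_weaken j w v : shallow C j w v -> shallow C j w.+1 v.
Proof.
elim: j w v => [|j IH] w v //; rewrite !shallowS; case: (v < _) => //=.
case: (large C v) => [|/allP H]; last by apply/allP => x /H /IH.
by case: w => // w /= /allP H; apply/allP => x /H /IH.
Qed.

Lemma shallow_child j w v u : inputs C <= v -> w <= 1 ->
  shallow C j.+1 w v -> u \in in_nbrs C v -> shallow C j w u.
Proof.
rewrite shallowS ltnNge => -> /= w_le1; case: ifP => _; last by move/allP/[apply].
by case: w w_le1 => [|[|w]] //= _ /allP/[apply] /shallow_weaken.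
Qed.

Lemma universal_mono j x : universal C j x -> universal C j.+1 x.
Proof.
case/and4P=> h1 h2 h3 h4; apply/and4P; split=> //.
by apply/allP => z /(allP h4); apply: shallow_mono.
Qed.

Lemma gate_in_nbrs v : inputs C <= v < nodes C ->
  fan_in_ok (node_gate C v) && (in_nbrs C v == (node_gate C v).2).
Proof.
move=> v_gate; have [-> _ _] := wfC.2 v v_gate.
by rewrite in_nbrs_gate ?eqxx //; case/andP: v_gate.
Qed.

(** Universal conditions arise only at large gates, each of which uses up a unit of weft. Thus
    [w = 1] leaves budget 0 below such a gate, and [w = 0] yields literals only. *)
Lemma dnf_claims j w v b c x : v < nodes C -> w <= 1 -> shallow C j w v ->
  c \in dnf C j v b -> x \in c -> (x.1 < inputs C) || (0 < w) && universal C j x.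
Proof.
elim: j v b c => [|j IH] v b c v_node w_le1.
  by rewrite /=; case: ifP => //= v_in _; rewrite inE => /eqP-> /[!inE] /eqP->; rewrite v_in.
move=> sv /=; case: (ltnP v (inputs C)) => v_in.
  by rewrite inE => /eqP-> /[!inE] /eqP->; rewrite v_in.
have sub u b' c' : u \in in_nbrs C v -> c' \in dnf C j u b' -> x \in c' ->
    (x.1 < inputs C) || (0 < w) && universal C j.+1 x.
  move=> uv c'u xc'; have su := shallow_child v_in w_le1 sv uv.
  have /orP[->//|/andP[-> /universal_mono->]] :=
    IH _ _ _ (in_nbrs_node wfC v_node uv) w_le1 su c'u xc'.
  by rewrite orbT.
case: eqP => [_ /flatten_mapP[u uv cu]|/eqP conn_neq0]; first exact: sub cu.
case: ifP => [_ /flatten_mapP[u uv cu]|ndisj]; first exact: sub cu.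
case: ifP => lv.
  rewrite inE => /eqP-> /[!inE] /eqP->; apply/orP; right.
  move: sv; rewrite shallowS ltnNge v_in lv /= => /andP[w_gt0 Hall].
  have w0 : w.-1 = 0 by lia.
  rewrite w_gt0 /universal /= v_in v_node ndisj lt0n conn_neq0 /=.
  by apply: sub_all Hall => u; rewrite w0; apply: shallow_mono.
have [fan /eqP nbrsE] : fan_in_ok (node_gate C v) /\ in_nbrs C v == (node_gate C v).2.
  by apply/andP/gate_in_nbrs; rewrite v_in.
have size2 : 1 < size (in_nbrs C v).
  by move: fan conn_neq0; rewrite /fan_in_ok nbrsE; case: (node_gate C v) => -[].
case/allpairsP=> -[c1 c2] [/= c1P c2P ->]; rewrite mem_cat => /orP[] xc.
  by apply: sub c1P xc; rewrite mem_nth // ltnW.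
by apply: sub c2P xc; rewrite mem_nth.
Qed.

(** A disjunctive normal form of the negation of [c]: a literal is refuted by the opposite literal,
    a universal condition by any conjunction that gives one of the inputs the opposite value. *)
Definition refutations (d : nat) (c : seq (nat * bool)) :=
  flatten [seq if x.1 < inputs C then [:: [:: (x.1, ~~ x.2)]]
               else flatten [seq dnf C d u (~~ x.2) | u <- in_nbrs C x.1]
          | x <- c].

(** The inputs of a universal gate have weft 0, and there [dnf_claims] leaves only literals. *)
Lemma refutations_claims d c c' y :
  (forall x, x \in c -> (x.1 < inputs C) || universal C d x) ->
  c' \in refutations d c -> y \in c' -> y.1 < inputs C.
Proof.
move=> cP /flatten_mapP[[v b] /cP /=]; case: ltnP => v_in /=.
  by rewrite inE => _ /eqP-> /[!inE] /eqP->.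
case/and4P=> /= v_gate _ _ /allP sub /flatten_mapP[u uv c'u] yc'.
have u_node: u < nodes C by apply: in_nbrs_node uv; case/andP: v_gate.
by have := dnf_claims u_node (leq0n 1) (sub u uv) c'u yc'; rewrite orbF.
Qed.

Lemma size_refutations d c : all (fun c' => size c' <= 2 ^ d) (refutations d c).
Proof.
apply/allP => c' /flatten_mapP[[v b] _] /=; case: ifP => _.
  by rewrite inE => /eqP-> /=; rewrite expn_gt0.
by case/flatten_mapP=> u _; apply: (allP (size_dnf _ _ _)).
Qed.

End Claims.

Section Dnf.

Variables (C : circuit) (wfC : well_formed C) (a : seq bool).
Hypothesis size_a : size a = inputs C.

Definition holds (x : nat * bool) : bool := node_value C a x.1 == x.2.

Lemma node_value_disjunctive v b : inputs C <= v < nodes C ->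
  0 < conn_nat (node_gate C v).1 -> (node_value C a v == b) =
  (if disjunctive (node_gate C v).1 b then has else all)
    (fun u => node_value C a u == b) (in_nbrs C v).
Proof.
move=> v_gate; rewrite node_value_gate //.
have /andP[_ /eqP->] := gate_in_nbrs wfC v_gate.
case: node_gate => -[] //= us _; rewrite /gate_value /disjunctive /=;
  case: b => /=; rewrite ?eqb_id ?eqbF_neg -?has_predC -?all_predC ?negbK;
  do ?[by apply: eq_in_has => u _ /=; rewrite ?eqb_id ?eqbF_neg
      |by apply: eq_in_all => u _ /=; rewrite ?eqb_id ?eqbF_neg].
Qed.

(** Negations flip the value asked for, disjunctive gates unite the normal forms of their inputs,
    and small conjunctive gates use distributivity. At a large conjunctive gate the condition itself
    is the only conjunct. *)
Lemma dnfP j v b : v < nodes C -> shallow C j 1 v ->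
  (node_value C a v == b) = has (all holds) (dnf C j v b).
Proof.
elim: j v b => [|j IH] v b v_node.
  by rewrite /= orbF => ->; rewrite /= andbT orbF.
move=> sv /=; case: (ltnP v (inputs C)) => v_in; first by rewrite /= andbT orbF.
have v_gate: inputs C <= v < nodes C by rewrite v_in.
have child u b' : u \in in_nbrs C v ->
    (node_value C a u == b') = has (all holds) (dnf C j u b').
  move=> uv; apply: IH; first exact: in_nbrs_node uv.
  exact: shallow_child sv uv.
have [fan /eqP nbrsE] : fan_in_ok (node_gate C v) /\ in_nbrs C v == (node_gate C v).2.
  by apply/andP/gate_in_nbrs.
case: (conn_nat _ =P 0) => [conn0|/eqP conn_neq0].
  have [u nbrs1] : exists u, in_nbrs C v = [:: u].
    move: fan conn0; rewrite nbrsE /fan_in_ok.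
    by case: (node_gate C v) => -[] //= [|u []] // *; exists u.
  rewrite nbrs1 /= cats0 -child ?nbrs1 ?mem_head // node_value_gate //.
  rewrite /gate_value -nbrsE nbrs1; case: (node_gate C v) conn0 => -[] //= us _.
  by rewrite -/(node_value C a u); case: (node_value C a u); case: (b).
rewrite node_value_disjunctive // ?lt0n //; case: ifP => [_|ndisj].
  rewrite has_flatten has_map; apply: eq_in_has => u uv /=; exact: child.
case: ifP => lv.
  by rewrite /= andbT orbF /holds /= node_value_disjunctive ?lt0n // ndisj.
(* The in-neighbours of index 0 and 1 used by [dnf] are all of them, since the gate is neither a
   negation nor large. *)
have size2 : size (in_nbrs C v) = 2.
  move: lv fan conn_neq0; rewrite /large nbrsE /fan_in_ok.
  by case: (node_gate C v) => -[] us //=; lia.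
have {size2} [u1 [u2 nbrs2]] : exists u1 u2, in_nbrs C v = [:: u1; u2].
  by case: (in_nbrs C v) size2 => [|u1 [|u2 []]] // _; exists u1, u2.
rewrite nbrs2 /= andbT !child ?nbrs2 ?inE ?eqxx ?orbT //.
apply/andP/hasP => [[/hasP[c1 c1P h1] /hasP[c2 c2P h2]]|[c /allpairsP]].
  by exists (c1 ++ c2); [apply: allpairs_f | rewrite all_cat h1].
move=> [[c1 c2] [/= c1P c2P ->]]; rewrite all_cat => /andP[h1 h2].
by split; apply/hasP; [exists c1 | exists c2].
Qed.

Lemma refutationsP d c : 
  (forall x, x \in c -> (x.1 < inputs C) || universal C d x) ->
  all holds c = all (fun c' => ~~ all holds c') (refutations C d c).
Proof.
rewrite /refutations => cP; rewrite all_flatten all_map.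
apply: eq_in_all => -[v b] /cP /=; case: ltnP => v_in /=.
  by rewrite /holds /= andbT !andbT; case: (node_value C a v); case: b.
case/and4P=> /= v_gate conn_gt0 /negbTE ndisj /allP sub.
rewrite /holds /= node_value_disjunctive // ndisj all_flatten all_map.
apply: eq_in_all => u uv /=.
have u_node: u < nodes C by apply: in_nbrs_node uv; case/andP: v_gate.
transitivity (~~ has (all holds) (dnf C d u (~~ b))); last by rewrite -all_predC.
rewrite -dnfP //; last exact: shallow_weaken (sub u uv).
by case: (node_value C a u); case: (b).
Qed.

End Dnf.

(** * Choosing pairwise compatible items by Grundy sequences *)

(** A positive answer on an encoding yields some graph with this encoding, which has to be
    identified with the intended one. The unary prefix determines [n], and then the remaining blocks
    have known lengths. *)
Lemma enc_bipartite_inj n (e : rel 'I_n) (A : {set 'I_n})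
    n' (e' : rel 'I_n') (A' : {set 'I_n'}) :
  enc_bipartite e A = enc_bipartite e' A' ->
  exists E : n = n', (forall i j, e i j = e' (cast_ord E i) (cast_ord E j)) /\
    forall i, (i \in A) = (cast_ord E i \in A').
Proof.
move=> eq_enc; have eq_n: n = n'.
  have := congr1 (fun x => head 0 (tokens x)) eq_enc.
  by rewrite /enc_bipartite !tokens_enc_nat.
case: _ / eq_n e' A' eq_enc => e' A' /eqP.
rewrite /enc_bipartite !eqseq_cat ?size_map // eqxx /= => /andP[/eqP eqA /eqP eqE].
exists erefl; split=> [i j|i]; rewrite !cast_ord_id; last first.
  by move/eq_in_map: eqA => /(_ i); apply; rewrite mem_enum.
have pairE (f : rel 'I_n) : [seq f u v | u <- enum 'I_n, v <- enum 'I_n]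
    = [seq f p.1 p.2 | p <- [seq (u, v) | u <- enum 'I_n, v <- enum 'I_n]].
  by rewrite map_allpairs.
rewrite !pairE in eqE; move/eq_in_map: eqE => /(_ (i, j)); apply.
by apply: allpairs_f; rewrite mem_enum.
Qed.

Lemma card_le2 (n : nat) (B : {set 'I_n}) :
  (forall i j l : 'I_n, i < j -> j < l -> [/\ i \in B, j \in B & l \in B] -> False) ->
  #|B| <= 2.
Proof.
move=> H; rewrite leqNgt; apply/negP => /card_gt2P[x [y [z [[xB yB zB] [xy yz zx]]]]].
wlog: x y z xB yB zB xy yz zx / x < y => [IH|lt_xy].
  case: (ltngtP x y) => [lt|lt|/val_inj eq]; last by rewrite eq eqxx in xy.
    exact: (IH x y z).
  by apply: (IH y x z) => //; rewrite eq_sym.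
case: (ltngtP y z) => [lt|lt|/val_inj eq]; last by rewrite eq eqxx in yz.
  exact: (H x y z).
case: (ltngtP x z) => [lt'|lt'|/val_inj eq]; last by rewrite eq eqxx in zx.
  exact: (H x z y).
exact: (H z x y).
Qed.

Section Items.

Variables (item colour : eqType) (col : item -> colour).
(* The attributes of an item, as pairs of the index of a variable and of the
   value that the item assumes for this variable. *)
Variable view : item -> seq (nat * nat).

Definition conflict (z y : item) : bool :=
  has (fun p => has (fun q => (p.1 == q.1) && (p.2 != q.2)) (view y)) (view z).

Lemma conflictC z y : conflict z y = conflict y z.
Proof.
apply/hasP/hasP => -[p pz /hasP[q qy /andP[pq1 pq2]]]; exists q => //;
  by apply/hasP; exists p; rewrite // eq_sym pq1 eq_sym.
Qed.

Lemma conflictP z y : reflect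
  (exists r v v', [/\ (r, v) \in view z, (r, v') \in view y & v != v'])
  (conflict z y).
Proof.
apply: (iffP hasP) => [[[r v] vz /hasP[[r' v'] vy /= /andP[/eqP rr' ne]]]|].
  by rewrite -rr' in vy; exists r, v, v'.
move=> [r [v [v' [vz vy ne]]]]; exists (r, v) => //; apply/hasP; exists (r, v') => //=.
by rewrite eqxx.
Qed.

(** Side of the bipartition, number of the copy, and item; sequences are drawn from the side
    [true]. *)
Definition vertex : Type := (bool * (nat * item))%type.

Definition near (u v : nat * item) : bool :=
  ((u.1 == v.1) && (col u.2 == col v.2)) || conflict u.2 v.2.

Definition adjacent (u v : vertex) : bool := (u.1 != v.1) && near u.2 v.2.

Lemma adjacentC u v : adjacent u v = adjacent v u.
Proof.
by rewrite /adjacent /near conflictC eq_sym (eq_sym u.2.1) (eq_sym (col _)).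
Qed.

Definition vertices (M : nat) (Z : seq item) : seq vertex :=
  [seq (b, x) | b <- [:: true; false], x <- [seq (t, z) | t <- iota 0 M, z <- Z]].

Definition enc_vertices (V : seq vertex) : seq bool :=
  enc_nat (size V) ++ [seq u.1 | u <- V] ++ [seq adjacent u v | u <- V, v <- V].

Section Graph.

Variable V : seq vertex.
Let tV := in_tuple V.
Let e : rel 'I_(size V) := fun i j => adjacent (tnth tV i) (tnth tV j).
Let A := [set i | (tnth tV i).1].

Lemma enc_verticesE : enc_vertices V = enc_bipartite e A.
Proof.
have VE: V = [seq tnth tV i | i <- enum 'I_(size V)].
  by rewrite map_tnth_enum.
rewrite /enc_vertices /enc_bipartite; congr (_ ++ _).
rewrite {1 2 3}VE allpairs_mapl; congr (_ ++ _).
  by rewrite -map_comp; apply: eq_map => i; rewrite /= inE.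
congr flatten; apply: eq_map => i; rewrite -map_comp //.
Qed.

Lemma one_sided_grundyP k :
  one_sided_grundy_total_domination (enc_vertices V) k <->
  exists s : k.-tuple 'I_(size V), total_dominating_sequence e s /\ {subset s <= A}.
Proof.
have bip: bipartite_graph e A.
  split=> [i j|i j]; first exact: adjacentC.
  by rewrite !inE => /andP[].
split=> [[n [e' [A' [_ eq_enc [s tds sA]]]]]|[s [tds sA]]]; last first.
  by exists _, e, A; split; [|exact: enc_verticesE|exists s].
rewrite enc_verticesE in eq_enc; have [E [eqe eqA]] := enc_bipartite_inj eq_enc.
case: _ / E e' A' s tds sA eqe eqA {eq_enc} => e' A' s tds sA eqe eqA.
have eqe' i j : e i j = e' i j by rewrite eqe !cast_ord_id.
have nbE i : nbhd e i = nbhd e' i by apply/setP => j; rewrite !inE eqe'.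
exists s; split; last by move=> i /sA; rewrite eqA cast_ord_id.
split=> [|i]; first by case: tds.
have := tds.2 i; rewrite nbE; congr (_ :\: _ != _).
by apply: eq_bigr => j _; rewrite nbE.
Qed.

End Graph.

Variables (cols : seq colour) (m : nat) (Z : seq item).
Hypothesis cols_gt0 : 0 < size cols.
Hypothesis uniq_cols : uniq cols.
Hypothesis col_Z : {in Z, forall z, col z \in cols}.
Hypothesis view_lt : {in Z, forall z (r : nat), r \in map fst (view z) -> r < m}.
Hypothesis view_col :
  {in Z &, forall z y, col z = col y -> map fst (view z) = map fst (view y)}.

(** One more than the bound [m.*2] of [card_conflicts], which gives [colour_used] its strict
    inequality. *)
Let M := m.*2.+1.
Let N := size cols * M.

(** On a variable shared by [x] and [z], the item [y] has a value as well, and both values agree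
    with it. *)
Lemma conflict_trans z y x : map fst (view z) = map fst (view y) ->
  ~~ conflict x y -> ~~ conflict z y -> ~~ conflict x z.
Proof.
move=> zy nxy nzy; apply/conflictP => -[r [v [v' [vx vz ne]]]].
have: r \in map fst (view y) by rewrite -zy; apply/mapP; exists (r, v').
case/mapP=> -[r' v''] vy /= rr'; rewrite -{}rr' in vy.
have e1 : v == v''.
  by apply/negPn/negP => ne'; move/conflictP: nxy; apply; exists r, v, v''.
have e2 : v' == v''.
  by apply/negPn/negP => ne'; move/conflictP: nzy; apply; exists r, v', v''.
by rewrite (eqP e1) (eqP e2) eqxx in ne.
Qed.

Section Counting.

(** [a i] is the [i]-th vertex of the sequence and [b i] a private neighbour of it, both without
    their sides. *)
Variables (a b : 'I_N -> nat * item).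
Hypothesis aZ : forall i, (a i).1 < M /\ (a i).2 \in Z.
Hypothesis bZ : forall i, (b i).2 \in Z.
Hypothesis near_ab : forall i, near (a i) (b i).
Hypothesis far_ab : forall j i : 'I_N, j < i -> ~~ near (a j) (b i).

Let conflict_at (r : nat) (z y : item) : bool :=
  has (fun p => has (fun q => [&& p.1 == r, q.1 == r & p.2 != q.2]) (view y)) (view z).

(* Along a sequence of pairs in conflict at [r], all but the first and the
   last item would only use one value of the attribute [r]. *)
Lemma card_conflict_at r : #|[set i | conflict_at r (a i).2 (b i).2]| <= 2.
Proof.
apply: card_le2 => i j l lt_ij lt_jl; rewrite !inE.
case=> /hasP[[r1 u] ui /hasP[[_ _] _ /= /and3P[/eqP r1E _ _]]]; rewrite {}r1E in ui.
case/hasP=> -[r2 v] vj /hasP[[r3 v'] v'j /= /and3P[/eqP r2E /eqP r3E ne]].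
rewrite {}r2E in vj; rewrite {}r3E in v'j.
case/hasP=> -[_ _] _ /hasP[[r4 w] wl /= /and3P[_ /eqP r4E _]]; rewrite {}r4E in wl.
have agree (x x' : 'I_N) p q : x < x' -> (r, p) \in view (a x).2 ->
    (r, q) \in view (b x').2 -> p = q.
  move=> /far_ab; rewrite negb_or => /andP[_ /conflictP nc] px qx'.
  by apply/eqP/negPn/negP => ne'; apply: nc; exists r, p, q.
have e1 := agree _ _ _ _ lt_ij ui v'j.
have e2 := agree _ _ _ _ lt_jl vj wl.
have e3 := agree _ _ _ _ (ltn_trans lt_ij lt_jl) ui wl.
by rewrite e2 -e3 e1 eqxx in ne.
Qed.

Lemma card_conflicts : #|[set i | conflict (a i).2 (b i).2]| <= m.*2.
Proof.
pose B r := [set i | conflict_at r (a i).2 (b i).2].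
apply: (@leq_trans #|\bigcup_(r < m) B r|).
  apply/subset_leq_card/subsetP => i; rewrite inE => /conflictP[r [v [v' [vz vy ne]]]].
  have r_lt: r < m.
    by apply: (view_lt (aZ i).2); apply/mapP; exists (r, v).
  apply/bigcupP; exists (Ordinal r_lt) => //; rewrite inE.
  by apply/hasP; exists (r, v) => //; apply/hasP; exists (r, v'); rewrite //= eqxx.
apply: (@leq_trans (\sum_(r < m) 2)); last by rewrite sum_nat_const card_ord muln2.
elim/big_ind2: _ => [|x y x' y' h h'|r _]; first by rewrite cards0.
  by apply: leq_trans (leq_card_setU _ _) (leq_add h h').
exact: card_conflict_at.
Qed.

Lemma near_same i : ~~ conflict (a i).2 (b i).2 ->
  (a i).1 = (b i).1 /\ col (a i).2 = col (b i).2.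
Proof. by have := near_ab i; rewrite /near => /orP[/andP[/eqP-> /eqP->]|->]. Qed.

(** Conflict-free pairs differ in colour or copy number, for otherwise the earlier vertex would be
    near the private neighbour of the later one. If [c] did not occur, there would be at most
    [N - M] of them, but at least [N - m.*2] pairs are conflict-free. *)
Lemma colour_used c : c \in cols ->
  exists i, ~~ conflict (a i).2 (b i).2 /\ col (a i).2 = c.
Proof.
move=> c_col; pose G := [set i | ~~ conflict (a i).2 (b i).2].
case: (boolP [exists i in G, col (a i).2 == c]) => [/existsP[i]|].
  by rewrite inE => /andP[iG /eqP]; exists i.
move/existsPn => notc.
have cardG: N - m.*2 <= #|G|.
  have := cardsC [set i | conflict (a i).2 (b i).2].
  have -> : ~: [set i | conflict (a i).2 (b i).2] = G by apply/setP => i; rewrite !inE.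
  by have := card_conflicts; rewrite card_ord; lia.
pose f i := (col (a i).2, (a i).1).
have f_inj : {in G &, injective f}.
  move=> i j; rewrite !inE => iG jG [cE tE].
  have absurd (x y : 'I_N) : ~~ conflict (a x).2 (b x).2 -> ~~ conflict (a y).2 (b y).2 ->
      col (a x).2 = col (a y).2 -> (a x).1 = (a y).1 -> ~ x < y.
    move=> _ yG c' t' /far_ab; have [t1 c1] := near_same yG.
    by rewrite /near t' t1 c' c1 !eqxx.
  case: (ltngtP i j) => [lt|lt|/val_inj //]; first by case: (absurd i j).
  by case: (absurd j i).
have: size [seq f i | i <- enum G]
    <= size [seq (c', t) | c' <- rem c cols, t <- iota 0 M].
  apply: uniq_leq_size.
    by rewrite map_inj_in_uniq ?enum_uniq // => i j; rewrite !mem_enum; apply: f_inj.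
  move=> x /mapP[i]; rewrite mem_enum => iG -> {x}; have [lt_t zZ] := aZ i.
  apply: allpairs_f; last by rewrite mem_iota.
  rewrite mem_rem_uniq // inE col_Z // andbT.
  by have := notc i; rewrite iG.
rewrite size_map -cardE size_allpairs size_iota size_rem //.
have NE : N = (size cols).-1 * M + M by rewrite -mulSnr prednK.
have MS : M = m.*2.+1 by [].
move=> cardG'; exfalso; move: (_.-1 * M) NE cardG' => x NE cardG'; lia.
Qed.

(** Each colour receives the item of a conflict-free pair. For [i <= j], the item of [a i] does not
    conflict with that of [b j], which has the colour, hence the variables, of [a j] and agrees with
    it; [conflict_trans] concludes. *)
Lemma selection_of_sequence : exists sel : colour -> item,
  {in cols, forall c, sel c \in Z /\ col (sel c) = c} /\
  {in cols &, forall c c', ~~ conflict (sel c) (sel c')}.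
Proof.
have N_gt0 : 0 < N by rewrite muln_gt0 cols_gt0.
(* The default is returned only if the colour has no conflict-free pair, which [colour_used]
   excludes on [cols]. *)
pose idx c : 'I_N := odflt (Ordinal N_gt0)
  [pick i | ~~ conflict (a i).2 (b i).2 & col (a i).2 == c].
have idxP c : c \in cols ->
    ~~ conflict (a (idx c)).2 (b (idx c)).2 /\ col (a (idx c)).2 = c.
  move=> /colour_used[i [h1 h2]]; rewrite /idx; case: pickP => [j /andP[? /eqP]|/(_ i)] //.
  by rewrite h1 h2 eqxx.
exists (fun c => (a (idx c)).2); split=> [c /idxP[_ ->]|]; first by split=> //; case: (aZ (idx c)).
have main (i j : 'I_N) : i <= j -> ~~ conflict (a i).2 (b i).2 ->
    ~~ conflict (a j).2 (b j).2 -> ~~ conflict (a i).2 (a j).2.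
  move=> le_ij hi hj; have [_ cE] := near_same hj.
  apply: (@conflict_trans _ (b j).2) => //.
    by apply: view_col => //; case: (aZ j).
  move: le_ij; rewrite leq_eqVlt => /predU1P[/val_inj<- //|/far_ab].
  by rewrite negb_or => /andP[].
move=> c c' /idxP[h _] /idxP[h' _].
case/orP: (leq_total (idx c) (idx c')) => le; first exact: main.
by rewrite conflictC; apply: main.
Qed.

End Counting.

(** A sequence and chosen private neighbours are the data of [selection_of_sequence]. Conversely,
    the copies of the selected items on both sides induce a perfect matching, so any order of those
    on side [true] is a total dominating sequence, with the partners as private neighbours. *)
Theorem compatible_items :
  one_sided_grundy_total_domination (enc_vertices (vertices M Z)) N <->
  exists sel : colour -> item,
    {in cols, forall c, sel c \in Z /\ col (sel c) = c} /\
    {in cols &, forall c c', ~~ conflict (sel c) (sel c')}.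
Proof.
rewrite one_sided_grundyP; set V := vertices M Z.
have memV (b : bool) t z : ((b, (t, z)) \in V) = (t < M) && (z \in Z).
  apply/allpairsP/andP => [[[b' x] [_ /allpairsP[[t' z'] [t'M z'Z xE]]]]|[tM zZ]].
    by rewrite [(_, _).2]/= in xE *; rewrite xE mem_iota in t'M * => -[_ -> ->].
  exists (b, (t, z)); split=> //; first by case: b.
  by apply: allpairs_f => //; rewrite mem_iota.
have tnthV i : (tnth (in_tuple V) i).2.1 < M /\ (tnth (in_tuple V) i).2.2 \in Z.
  by have := mem_tnth i (in_tuple V); case: (tnth _ _) => b [t z]; rewrite memV => /andP.
split=> [[s [[us tds] sA]]|[sel [selP selC]]].
  have {}tds i : exists w, w \in nbhd (fun i j => adjacent (tnth (in_tuple V) i)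
      (tnth (in_tuple V) j)) (tnth s i) :\:
      \bigcup_(j < N | j < i) nbhd (fun i j => adjacent (tnth (in_tuple V) i)
      (tnth (in_tuple V) j)) (tnth s j).
    exact/set0Pn/tds.
  have [w wP] := fin_all_exists tds.
  have sideA i : (tnth (in_tuple V) (tnth s i)).1.
    by have := sA _ (mem_tnth i s); rewrite inE.
  have wadj i : adjacent (tnth (in_tuple V) (tnth s i)) (tnth (in_tuple V) (w i)).
    by have := wP i; rewrite !inE => /andP[].
  apply: (@selection_of_sequence (fun i => (tnth (in_tuple V) (tnth s i)).2)
                                 (fun i => (tnth (in_tuple V) (w i)).2)) => [i|i|i|j i lt_ji].
  - exact: tnthV.
  - by have [] := tnthV (w i).
  - by have /andP[] := wadj i.
  - have /andP[+ _] := wadj i; have := wP i; rewrite inE => /andP[/bigcupP nw _] side.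
    apply/negP => nr; apply: nw; exists j => //; rewrite inE /adjacent nr andbT.
    by move: side; rewrite !sideA.
(* The edges of the matching are indexed by colour and copy number. *)
pose P := [seq (c, t) | c <- cols, t <- iota 0 M].
have sizeP : size P = N by rewrite size_allpairs size_iota.
have uniqP : uniq P.
  apply: allpairs_uniq => [||[c t] [c' t'] _ _ [-> ->]] //; exact: iota_uniq.
have N_gt0 : 0 < N by rewrite muln_gt0 cols_gt0.
have memP x : x \in P -> x.1 \in cols /\ x.2 < M.
  by case/allpairsP => -[c t] [cc tM ->]; rewrite mem_iota in tM.
have Pvertex b x : x \in P -> (b, (x.2, sel x.1)) \in V.
  by case/memP => xc xM; rewrite memV xM; case: (selP _ xc).
have [x0 x0P] : exists x0, x0 \in P.
  by case: P sizeP N_gt0 {uniqP memP Pvertex} => [<-//|x0 P' _ _]; exists x0; rewrite mem_head.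
have V_gt0 : 0 < size V by have := Pvertex true _ x0P; case: (V).
pose idx v : 'I_(size V) := odflt (Ordinal V_gt0) [pick i | tnth (in_tuple V) i == v].
have idxK v : v \in V -> tnth (in_tuple V) (idx v) = v.
  move=> vV; have /tnthP[i iE] : v \in in_tuple V by [].
  by rewrite /idx; case: pickP => [j /eqP//|/(_ i)]; rewrite -iE eqxx.
pose p (i : 'I_N) := nth x0 P i.
have pP i : p i \in P by rewrite mem_nth ?sizeP.
pose v b (i : 'I_N) := idx (b, ((p i).2, sel (p i).1)).
have vE b i : tnth (in_tuple V) (v b i) = (b, ((p i).2, sel (p i).1)).
  exact/idxK/Pvertex/pP.
have p_inj : injective p.
  by move=> i j /eqP; rewrite nth_uniq ?sizeP // => /eqP/val_inj.
have v_near b b' i j : adjacent (tnth (in_tuple V) (v b i)) (tnth (in_tuple V) (v b' j))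
    = (b != b') && (i == j).
  rewrite !vE /adjacent /near /=; congr andb.
  have [ci ti] := memP _ (pP i); have [cj tj] := memP _ (pP j).
  rewrite (negbTE (selC _ _ ci cj)) orbF (selP _ ci).2 (selP _ cj).2.
  by rewrite andbC -xpair_eqE -!surjective_pairing (inj_eq p_inj).
exists [tuple v true i | i < N]; split; last first.
  by move=> _ /mapP[i _ ->]; rewrite inE vE.
split=> [|i].
  rewrite map_inj_uniq ?enum_uniq // => i j eq_v.
  have := v_near true false i j; rewrite eq_v v_near eqxx /= => /esym/eqP//.
apply/set0Pn; exists (v false i); rewrite in_setD; apply/andP; split; last first.
  by rewrite inE tnth_mktuple v_near eqxx.
apply/bigcupP => -[j lt_ji]; rewrite inE tnth_mktuple v_near /= => /eqP ij.
by rewrite ij ltnn in lt_ji.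
Qed.

End Items.

(** * Assignments of weight k as increasing sequences *)

Section Positions.

Variables (k n : nat) (x : nat -> nat).
Hypothesis x0 : x 0 = 0.
Hypothesis xk : x k.+1 = n.+1.
Hypothesis incr_x : forall i, i <= k -> x i < x i.+1.

Lemma positions_lt i j : i < j -> j <= k.+1 -> x i < x j.
Proof.
elim: j => // j IH; rewrite ltnS leq_eqVlt => /predU1P[->|lt_ij] lt_jk.
  exact: incr_x.
by apply: ltn_trans (IH lt_ij (ltnW lt_jk)) _; apply: incr_x.
Qed.

Lemma positions_inj i j : i <= k.+1 -> j <= k.+1 -> x i = x j -> i = j.
Proof.
move=> ik jk eq_x; case: (ltngtP i j) => // lt.
  by have := positions_lt lt jk; rewrite eq_x ltnn.
by have := positions_lt lt ik; rewrite eq_x ltnn.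
Qed.

Lemma gap_exists v : v < n -> exists2 i, i <= k & x i <= v.+1 < x i.+1.
Proof.
move=> lt_vn; have: x 0 <= v.+1 < x k.+1 by rewrite x0 xk.
elim: k => [|j IH] /andP[le0 lt]; first by exists 0; rewrite ?le0.
case: (leqP (x j.+1) v.+1) => [le|lt']; first by exists j.+1; rewrite ?le.
by case: IH => [|i ij ?]; [rewrite le0 | exists i => //; apply: leqW].
Qed.

(** No other position lies in the gap, and the index 0 causes no false match because its position 0
    is not of the form [v.+1]. *)
Lemma gap_value v i : i <= k -> x i <= v.+1 < x i.+1 ->
  (v.+1 == x i) = (v.+1 \in [seq x j | j <- iota 1 k]).
Proof.
move=> ik /andP[le lt]; apply/eqP/mapP => [e|[j]].
  exists i => //; rewrite mem_iota add1n ltnS ik andbT lt0n.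
  by apply/eqP => i0; rewrite i0 x0 in e.
rewrite mem_iota add1n ltnS => /andP[j_gt0 jk] e; rewrite e in le lt *.
congr x; case: (ltngtP i j) => // lt_ij; last first.
  by have := positions_lt lt_ij (leqW ik); lia.
move: lt_ij; rewrite leq_eqVlt => /predU1P[ij|/positions_lt /(_ (leqW jk))]; last by lia.
by rewrite ij ltnn in lt.
Qed.

Lemma assignment_of_positions : exists2 a : n.-tuple bool, weight a = k &
  forall v, v < n -> nth false a v = (v.+1 \in [seq x j | j <- iota 1 k]).
Proof.
pose xs := [seq x j | j <- iota 1 k].
have size_a : size [seq v.+1 \in xs | v <- iota 0 n] == n.
  by rewrite size_map size_iota.
exists (Tuple size_a) => [|v lt_vn]; last first.
  by rewrite (nth_map 0) ?size_iota // nth_iota.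
rewrite /weight /= count_map.
have uniq_xs : uniq xs.
  rewrite map_inj_in_uniq ?iota_uniq // => i j; rewrite !mem_iota => hi hj.
  by apply: positions_inj; lia.
have <- : size xs = k by rewrite size_map size_iota.
rewrite -size_filter -(size_map S); apply: perm_size; apply: uniq_perm => //.
  by rewrite (map_inj_uniq succn_inj) filter_uniq // iota_uniq.
move=> y; apply/mapP/idP => [[v]|y_xs].
  by rewrite mem_filter => /andP[/= + _] ->.
have [j] := mapP y_xs; rewrite mem_iota => jk yE.
have y_gt0 : 0 < y by rewrite yE -x0 positions_lt //; lia.
have y_le : y < n.+1 by rewrite yE -xk positions_lt //; lia.
exists y.-1; rewrite ?prednK // mem_filter /= prednK // y_xs mem_iota; lia.
Qed.

End Positions.

Lemma positions_of_assignment (k n : nat) (a : n.-tuple bool) : weight a = k ->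
  exists x : nat -> nat, [/\ x 0 = 0, x k.+1 = n.+1,
    forall i, i <= k -> x i < x i.+1 &
    forall v, v < n -> nth false a v = (v.+1 \in [seq x j | j <- iota 1 k])].
Proof.
move=> <-; pose xs := [seq v.+1 | v <- iota 0 n & nth false a v].
have size_xs : size xs = weight a.
  rewrite size_map size_filter /weight -{2}[val a](mkseq_nth false) count_map.
  by rewrite size_tuple.
have memX y : y \in xs -> 0 < y <= n.
  by case/mapP => v; rewrite mem_filter mem_iota => /andP[_ lt] ->.
(* The sentinels serve as the positions of the first and last index. *)
pose X := 0 :: rcons xs n.+1.
have sortedX : sorted ltn X.
  rewrite /X /= rcons_path; apply/andP; split.
    have := iota_ltn_sorted 1 n; rewrite (iotaDl 1 0) => srt.
    rewrite path_min_sorted; last by apply/allP => y /memX /andP[].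
    rewrite /xs -(filter_map S (fun y => nth false a y.-1)).
    exact: (sorted_filter ltn_trans).
  have := mem_last 0 xs; rewrite inE => /predU1P[->//|/memX/andP[_ le_n]].
  exact: le_n.
exists (nth 0 X); split=> //.
- by rewrite /= nth_rcons size_xs ltnn eqxx.
- move=> i ik; apply: (sorted_ltn_nth ltn_trans) => //;
    by rewrite inE /X /= size_rcons size_xs; lia.
move=> v lt_vn; have ->: [seq nth 0 X j | j <- iota 1 (weight a)] = xs.
  apply: (@eq_from_nth _ 0) => [|i]; rewrite size_map size_iota ?size_xs // => lt_i.
  by rewrite (nth_map 0) ?size_iota // nth_iota //= nth_rcons size_xs lt_i.
by rewrite /xs (mem_map succn_inj) mem_filter mem_iota leq0n add0n lt_vn !andbT.
Qed.

(** * The items of a circuit *)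

(* [(j, [:: (i, (lo, hi)); ...])]: the [j]-th disjunct of the normal form holds,
   and for each listed [i] the [i]-th and [i+1]-st positions are [lo] and [hi].
   Input [v] has position [v+1]; the position of index 0 is 0, and that of
   index [k+1] is the number of inputs plus one. *)
Definition item : Type := (nat * seq (nat * (nat * nat)))%type.

Definition item_colour (z : item) : seq nat := [seq g.1 | g <- z.2].

(** Variable 0 is the disjunct, and variable [i.+1] is the position of index [i]. The indices 0 to
    [k.+1] thus give [k.+3] variables in all. *)
Definition item_view (z : item) : seq (nat * nat) :=
  (0, z.1) :: flatten [seq [:: (g.1.+1, g.2.1); (g.1.+2, g.2.2)] | g <- z.2].

Fixpoint words T (q : nat) (s : seq T) : seq (seq T) :=
  if q is q'.+1 then [seq y :: t | y <- s, t <- words q' s] else [:: [::]].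

(** The two implications fix the end points of the sequence of positions. *)
Definition gap_ok (k n : nat) (g : nat * (nat * nat)) : bool :=
  [&& g.2.1 < g.2.2, (g.1 == 0) ==> (g.2.1 == 0) & (g.1 == k) ==> (g.2.2 == n.+1)].

Definition gaps (k n : nat) : seq (nat * (nat * nat)) :=
  [seq g <- [seq (i, h) | i <- iota 0 k.+1,
                          h <- [seq (lo, hi) | lo <- iota 0 n.+2, hi <- iota 0 n.+2]]
  | gap_ok k n g].

(** The literal is located in a listed gap, where, as in [gap_value], comparison with the left end
    decides its truth. *)
Definition true_in (gs : seq (nat * (nat * nat))) (l : nat * bool) : bool :=
  has (fun g => (g.2.1 <= l.1.+1 < g.2.2) && ((l.1.+1 == g.2.1) == l.2)) gs.

Definition unrefuted (d : nat) (C : circuit) (z : item) : bool :=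
  all (fun c => ~~ all (true_in z.2) c)
    (refutations C d (nth [::] (dnf C d (output C) true) z.1)).

Definition items (d : nat) (C : circuit) (k : nat) : seq item :=
  [seq z <- [seq (j, gs) | j <- iota 0 (size (dnf C d (output C) true)),
                           gs <- words (2 ^ d) (gaps k (inputs C))]
  | unrefuted d C z].

Definition item_colours (d k : nat) : seq (seq nat) := words (2 ^ d) (iota 0 k.+1).

Lemma mem_words (T : eqType) q (s : seq T) t :
  (t \in words q s) = (size t == q) && all (fun y => y \in s) t.
Proof.
elim: q t => [|q IH] t /=; first by rewrite inE; case: t.
apply/allpairsP/idP => [[[y u] [/= ys]]|].
  by rewrite IH => /andP[/eqP <- us] ->; rewrite /= eqxx ys.
by case: t => //= y u /and3P[/eqP[su] ys us]; exists (y, u); rewrite IH su eqxx ys us.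
Qed.

Lemma words_uniq (T : eqType) q (s : seq T) : uniq s -> uniq (words q s).
Proof.
move=> us; elim: q => //= q IH; apply: allpairs_uniq => //.
by move=> [y t] [y' t'] _ _ [-> ->].
Qed.

Lemma size_words T q (s : seq T) : size (words q s) = size s ^ q.
Proof. by elim: q => //= q IH; rewrite size_allpairs IH expnS. Qed.

Lemma mem_gaps k n g : g \in gaps k n -> g.1 <= k /\ gap_ok k n g.
Proof.
rewrite mem_filter => /andP[ok /allpairsP[[i h] [ik _ gE]]]; split=> //.
by rewrite gE /=; rewrite mem_iota in ik.
Qed.

Lemma item_viewP z p : p \in item_view z ->
  p = (0, z.1) \/
  exists2 g, g \in z.2 & p = (g.1.+1, g.2.1) \/ p = (g.1.+2, g.2.2).
Proof.
rewrite inE => /predU1P[->|/flatten_mapP[g gz]]; first by left.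
by rewrite !inE => /orP[]/eqP->; right; exists g; auto.
Qed.

Lemma item_view_lo z g : g \in z.2 -> (g.1.+1, g.2.1) \in item_view z.
Proof.
by move=> gz; rewrite inE; apply/orP; right; apply/flatten_mapP; exists g; rewrite ?inE ?eqxx.
Qed.

Lemma item_view_hi z g : g \in z.2 -> (g.1.+2, g.2.2) \in item_view z.
Proof.
by move=> gz; rewrite inE; apply/orP; right; apply/flatten_mapP; exists g; rewrite ?inE ?eqxx ?orbT.
Qed.

Lemma item_view_colour z y : item_colour z = item_colour y ->
  map fst (item_view z) = map fst (item_view y).
Proof.
have E t : map fst (item_view t)
    = 0 :: flatten [seq [:: i.+1; i.+2] | i <- item_colour t].
  by rewrite /item_view /= map_flatten -!map_comp.
by rewrite !E => ->.
Qed.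

Section Items.

Variables (d k : nat) (C : circuit).
Let n := inputs C.

Lemma item_in_colours : {in items d C k, forall z, item_colour z \in item_colours d k}.
Proof.
move=> z; rewrite mem_filter => /andP[_ /allpairsP[[j gs] [_ + ->]]].
rewrite !mem_words size_map => /andP[-> /allP gsP].
by apply/allP => _ /mapP[g /gsP/mem_gaps[gk _] ->]; rewrite mem_iota ltnS.
Qed.

Lemma item_view_lt :
  {in items d C k, forall z (r : nat), r \in map fst (item_view z) -> r < k.+3}.
Proof.
move=> z zI r /mapP[p pz ->]; have /andP[_ /allP cz] : 
  (size (item_colour z) == 2 ^ d) && all (fun i => i \in iota 0 k.+1) (item_colour z).
  by rewrite -mem_words; apply: item_in_colours.
case: (item_viewP pz) => [->//|[g gz]].
have := cz _ (map_f fst gz); rewrite mem_iota ltnS /= => gk.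
by case=> -> /=; rewrite !ltnS; [apply: ltnW | ].
Qed.

Hypothesis wfC : well_formed C.
Hypothesis shC : shallow C d 1 (output C).

Let D := dnf C d (output C) true.

Let D_claims c y : c \in D -> y \in c -> (y.1 < n) || universal C d y.
Proof. by move=> cD yc; have := dnf_claims wfC (output_node wfC) _ shC cD yc; apply. Qed.

(** All items use the same true disjunct and the positions of the same assignment, so no two
    conflict. A refutation true in the listed gaps would be true under [a]. *)
Lemma selection_of_assignment (a : n.-tuple bool) : weight a = k -> satisfies a ->
  exists sel : seq nat -> item,
    {in item_colours d k, forall c, sel c \in items d C k /\ item_colour (sel c) = c} /\
    {in item_colours d k &, forall c c', ~~ conflict item_view (sel c) (sel c')}.
Proof.
move=> wa sat; have [x [x0 xk incr_x aE]] := positions_of_assignment wa.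
have size_a : size a = inputs C by rewrite size_tuple.
have: has (all (holds C a)) D.
  by rewrite -(dnfP wfC size_a _ (output_node wfC) shC) eqb_id.
move=> hasD; pose j := find (all (holds C a)) D.
have jD : j < size D by rewrite -has_find.
have holdsj : all (holds C a) (nth [::] D j) by apply: nth_find.
pose sel c : item := (j, [seq (i, (x i, x i.+1)) | i <- c]).
exists sel; split=> [c|c c' _ _].
  rewrite mem_words => /andP[size_c /allP ck]; split; last first.
    by rewrite /item_colour /= -map_comp map_id.
  rewrite mem_filter; apply/andP; split; last first.
    apply: allpairs_f; first by rewrite mem_iota.
    rewrite mem_words size_map size_c; apply/allP => _ /mapP[i /ck + ->].
    rewrite mem_iota ltnS => /= ik.
    have x_le l : l <= k.+1 -> x l < n.+2.
      rewrite leq_eqVlt => /predU1P[->|lk]; first by rewrite xk.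
      by apply: ltn_trans (positions_lt incr_x lk (leqnn _)) _; rewrite xk.
    have ok : gap_ok k n (i, (x i, x i.+1)).
      rewrite /gap_ok /= incr_x //=.
      by apply/andP; split; apply/implyP => /eqP->; rewrite ?x0 ?xk.
    rewrite mem_filter ok andTb.
    apply: allpairs_f; first by rewrite mem_iota.
    by apply: allpairs_f; rewrite mem_iota x_le //; lia.
  move: holdsj; rewrite (refutationsP wfC size_a (d := d)) => [/allP nref|y]; last first.
    by apply: D_claims; apply: mem_nth.
  apply/allP => c' c'R; apply: contra (nref _ c'R) => /allP c'T.
  apply/allP => y yc'; have /hasP[_ /mapP[i /ck + ->]] := c'T _ yc'.
  rewrite mem_iota ltnS => /= ik /andP[in_gap /eqP yE].
  have y_in : y.1 < inputs C.
    apply: (refutations_claims wfC (d := d) _ c'R yc') => z.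
    by apply: D_claims; apply: mem_nth.
  by rewrite /holds -yE node_value_input // aE // (gap_value x0 xk incr_x ik in_gap).
(* The common value that all selected items give to variable [r]. *)
pose val r := if r is i.+1 then x i else j.
have viewE b p : p \in item_view (sel b) -> p.2 = val p.1.
  by case/item_viewP => [->//|[_ /mapP[i _ ->] [] ->]].
apply/conflictP => -[r [v [v' [/viewE /= -> /viewE /= -> ]]]].
by rewrite eqxx.
Qed.

(** The positions are read off from the items whose colour is a constant word, and the other items
    agree with them. If a refutation of the common disjunct held, the item whose colour lists the
    gaps of its literals would fail its test. *)
Lemma assignment_of_selection (sel : seq nat -> item) :
  {in item_colours d k, forall c, sel c \in items d C k /\ item_colour (sel c) = c} ->
  {in item_colours d k &, forall c c', ~~ conflict item_view (sel c) (sel c')} ->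
  exists2 a : n.-tuple bool, weight a = k & satisfies a.
Proof.
move=> selP selC; pose q := 2 ^ d; have q_gt0 : 0 < q by rewrite expn_gt0.
have agree c c' r v v' : c \in item_colours d k -> c' \in item_colours d k ->
    (r, v) \in item_view (sel c) -> (r, v') \in item_view (sel c') -> v = v'.
  move=> cc cc' rv rv'; apply/eqP/negPn/negP => ne.
  by move/conflictP: (selC _ _ cc cc'); apply; exists r, v, v'.
have constP i : i <= k -> nseq q i \in item_colours d k.
  move=> ik; rewrite mem_words size_nseq eqxx; apply/allP => l /nseqP[-> _].
  by rewrite mem_iota.
have gapP c g : c \in item_colours d k -> g \in (sel c).2 -> g \in gaps k n.
  move=> /selP[+ _]; rewrite mem_filter => /andP[_ /allpairsP[[j gs] [_ + ->]]].
  by rewrite mem_words => /andP[_ /allP]; apply.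
have exgap c i : c \in item_colours d k -> i \in c ->
    exists2 g, g \in (sel c).2 & g.1 = i.
  by move=> cc; have [_ {1}<-] := selP _ cc; case/mapP => g gc ->; exists g.
pose gap i := head (0, (0, 0)) (sel (nseq q i)).2.
have gapE i : i <= k -> gap i \in (sel (nseq q i)).2 /\ (gap i).1 = i.
  move=> ik; have [_ colE] := selP _ (constP i ik).
  rewrite /gap; move: colE; rewrite /item_colour; case: (sel _).2 => [|g gs] /=.
    by case: (q) q_gt0.
  by rewrite mem_head; case: (q) q_gt0 => //= q' _ [].
(* The last position is no left end of a gap, so it is taken from the right end of gap [k]. *)
pose x i := if i <= k then (gap i).2.1 else (gap k).2.2.
have loE c g : c \in item_colours d k -> g \in (sel c).2 -> g.2.1 = x g.1.
  move=> cc gc; have [gk _] := mem_gaps (gapP _ _ cc gc).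
  have [h1 h2] := gapE _ gk; rewrite /x gk.
  apply: (agree c (nseq q g.1) g.1.+1) => //; [exact: constP|exact: item_view_lo|].
  by rewrite -{1}h2; apply: item_view_lo.
(* The right end of gap [i] and the left end of gap [i.+1] are the same variable [i.+2], so
   consecutive gaps fit together. *)
have hiE c g : c \in item_colours d k -> g \in (sel c).2 -> g.2.2 = x g.1.+1.
  move=> cc gc; have [gk _] := mem_gaps (gapP _ _ cc gc).
  rewrite /x; case: ltnP => [lt|ge].
    have [h1 h2] := gapE _ lt.
    apply: (agree c (nseq q g.1.+1) g.1.+2) => //; [exact: constP|exact: item_view_hi|].
    by rewrite -{1}h2; apply: item_view_lo.
  have gE : g.1 = k by lia.
  have [h1 h2] := gapE k (leqnn k).
  apply: (agree c (nseq q k) k.+2) => //; [exact: constP| |].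
    by rewrite -{1}gE; apply: item_view_hi.
  by rewrite -{1}h2; apply: item_view_hi.
have gap_props i : i <= k -> gap_ok k n (i, (x i, x i.+1)).
  move=> ik; have [h1 h2] := gapE _ ik.
  have [_] := mem_gaps (gapP _ _ (constP i ik) h1).
  by rewrite /gap_ok /= (loE _ _ (constP i ik) h1) (hiE _ _ (constP i ik) h1) h2.
have x0 : x 0 = 0 by have /and3P[_ /= /eqP] := gap_props 0 (leq0n k).
have xk : x k.+1 = n.+1.
  by have /and3P[_ _ /=] := gap_props k (leqnn k); rewrite eqxx => /eqP.
have incr_x i : i <= k -> x i < x i.+1 by move/gap_props/and3P => [].
have [a wa aE] := assignment_of_positions x0 xk incr_x.
have size_a : size a = inputs C by rewrite size_tuple.
exists a => //; pose c0 := nseq q 0; have c0P : c0 \in item_colours d k by exact: constP.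
pose j := (sel c0).1.
have jD : j < size D.
  have [+ _] := selP _ c0P; rewrite mem_filter => /andP[_ /allpairsP[[j' gs]]].
  by rewrite /j; case=> + _ -> /=; rewrite mem_iota.
have jE c : c \in item_colours d k -> (sel c).1 = j.
  by move=> cc; apply: (agree c c0 0) => //; rewrite mem_head.
rewrite -[satisfies a]eqb_id (dnfP wfC size_a _ (output_node wfC) shC).
apply/hasP; exists (nth [::] D j); first exact: mem_nth.
have cP y : y \in nth [::] D j -> (y.1 < n) || universal C d y.
  by apply: D_claims; apply: mem_nth.
rewrite (refutationsP wfC size_a cP); apply/allP => c' c'R; apply/negP => /allP c'T.
have gapy (y : nat * bool) : exists i, y \in c' -> i <= k /\ x i <= y.1.+1 < x i.+1.
  case: (boolP (y \in c')) => [yc'|]; last by exists 0.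
  have [i ik h] := gap_exists x0 xk (refutations_claims wfC cP c'R yc').
  by exists i.
have {gapy} [f fP] : exists f : nat * bool -> nat,
    forall y, y \in c' -> f y <= k /\ x (f y) <= y.1.+1 < x (f y).+1.
  exists (fun y => find (fun i => x i <= y.1.+1 < x i.+1) (iota 0 k.+1)) => y yc'.
  have [i] := gapy y => /(_ yc')[ik h].
  have hs : has (fun i => x i <= y.1.+1 < x i.+1) (iota 0 k.+1).
    by apply/hasP; exists i; rewrite ?mem_iota.
  have := hs; rewrite has_find size_iota ltnS => fk; split=> //.
  by have := nth_find 0 hs; rewrite nth_iota.
(* Colours are words of length exactly [q], so the gap indices of the literals are padded with 0. *)
pose c := [seq f y | y <- c'] ++ nseq (q - size c') 0.
have size_c' : size c' <= q by apply: (allP (size_refutations _ _ _)) c'R.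
have cc : c \in item_colours d k.
  rewrite mem_words size_cat size_map size_nseq subnKC // eqxx andTb all_cat.
  apply/andP; split; last by apply/allP => l /nseqP[-> _].
  by apply/allP => _ /mapP[y /fP[fk _] ->]; rewrite mem_iota.
have [+ colE] := selP _ cc; rewrite mem_filter => /andP[+ _].
rewrite /unrefuted jE // => /allP/(_ _ c'R)/negP; apply; apply/allP => y yc'.
have [fk in_gap] := fP _ yc'.
have [|g gc gE] := exgap c (f y) cc.
  by rewrite mem_cat map_f.
apply/hasP; exists g => //; rewrite (loE c) // (hiE c) // gE in_gap /=.
have := c'T _ yc'; rewrite /holds => /eqP yE.
have y_in := refutations_claims wfC cP c'R yc'.
by rewrite -yE node_value_input // aE // (gap_value x0 xk incr_x fk in_gap).
Qed.

End Items.

(** * The reduction *)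

(** Encoding the parsed circuit again tests whether [x] is an encoding at all. *)
Definition valid (d : nat) (x : seq bool) : bool :=
  [&& enc_circuit (parse x) == x, well_formedb (parse x) &
      shallow (parse x) d 1 (output (parse x))].

(** There are [y.2.+3] variables and [y.2.+1 ^ (2 ^ d)] colours, so the new parameter depends only
    on the old one. An invalid input gets no items and becomes a negative instance. *)
Definition reduction (d : nat) (y : seq bool * nat) : seq bool * nat :=
  (enc_vertices item_colour item_view (vertices (y.2.+3).*2.+1
     (if valid d y.1 then items d (parse y.1) y.2 else [::])),
   y.2.+1 ^ (2 ^ d) * (y.2.+3).*2.+1).

Lemma validP d x : reflect
  (exists C, [/\ well_formed C, weft_at_most 1 C, depth_at_most d C & x = enc_circuit C])
  (valid d x).
Proof.
apply: (iffP and3P) => [[/eqP xE /well_formedP wf sh]|[C [wf Hw Hd ->]]].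
  by exists (parse x); have [Hw Hd] := (weft_depth_shallow wf 1 d).2 sh; split.
rewrite parseK eqxx; split=> //; first exact/well_formedP.
exact/(weft_depth_shallow wf 1 d).
Qed.

Lemma reduction_correct d x k :
  weighted_circuit_sat 1 d x k <->
  one_sided_grundy_total_domination (reduction d (x, k)).1 (reduction d (x, k)).2.
Proof.
rewrite /reduction [(_, _).1]/= [(_, _).2]/=.
have size_cols : size (item_colours d k) = k.+1 ^ (2 ^ d).
  by rewrite size_words size_iota.
rewrite -size_cols; set Z := if _ then _ else _.
have ZP z : z \in Z -> z \in items d (parse x) k by rewrite /Z; case: ifP.
rewrite compatible_items; first last.
- by move=> z y _ _; apply: item_view_colour.
- by move=> z /ZP; apply: item_view_lt.
- by move=> z /ZP; apply: item_in_colours.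
- exact/words_uniq/iota_uniq.
- by rewrite size_cols expn_gt0.
split=> [[C [wf Hw Hd xE [a wa sat]]]|[sel [selP selC]]].
  have sh := (weft_depth_shallow wf 1 d).1 (conj Hw Hd).
  have vx : valid d x by apply/validP; exists C.
  rewrite /Z vx xE parseK; exact: selection_of_assignment wa sat.
(* Since some colour exists, its selected item witnesses that the item list is nonempty, hence that
   the input is valid. *)
have [c cc] : exists c, c \in item_colours d k.
  case: (item_colours d k) size_cols => [|c s _]; last by exists c; rewrite mem_head.
  by move/eqP; rewrite eq_sym expn_eq0.
have vx : valid d x.
  by have [+ _] := selP _ cc; rewrite /Z; case: ifP.
have /validP[C [wf Hw Hd xE]] := vx.
have sh := (weft_depth_shallow wf 1 d).1 (conj Hw Hd).
exists C; split=> //; rewrite /Z vx xE parseK in selP.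
exact: assignment_of_selection selP selC.
Qed.

(** * The reduction takes polynomial time *)

Section PolytimeReduction.

Implicit Types A : Type.

Lemma pt_nat_of_bool A (cA : codable A) (f : A -> bool) :
  polytime f -> polytime (fun x => nat_of_bool (f x)).
Proof.
move=> pf; apply: (@pt_ext _ _ _ _ _ (fun x => if f x then 1 else 0)); last by pt.
by move=> x; case: (f x).
Qed.

Lemma pt_double A (cA : codable A) (f : A -> nat) :
  polytime f -> polytime (fun x => (f x).*2).
Proof.
move=> pf; apply: (@pt_ext _ _ _ _ _ (fun x => f x + f x)); last by pt.
by move=> x; rewrite addnn.
Qed.

Lemma pt_node_gate A (cA : codable A) (C : A -> circuit) (v : A -> nat) :
  polytime C -> polytime v -> polytime (fun x => node_gate (C x) (v x)).
Proof. by move=> pC pv; rewrite /node_gate; pt. Qed.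

Lemma pt_in_nbrs A (cA : codable A) (C : A -> circuit) (v : A -> nat) :
  polytime C -> polytime v -> polytime (fun x => in_nbrs (C x) (v x)).
Proof. by move=> pC pv; rewrite /in_nbrs /node_gate; pt. Qed.

Lemma pt_large A (cA : codable A) (C : A -> circuit) (v : A -> nat) :
  polytime C -> polytime v -> polytime (fun x => large (C x) (v x)).
Proof. by move=> pC pv; rewrite /large /in_nbrs /node_gate; pt. Qed.

End PolytimeReduction.

Ltac pt_user ::= lazymatch goal with
  | |- polytime (fun x => conn_nat (@?f x)) => refine (pt_conn_nat (f := f) _); pt
  | |- polytime (fun x => inputs (@?f x)) => refine (pt_inputs (f := f) _); pt
  | |- polytime (fun x => gates (@?f x)) => refine (pt_gates (f := f) _); pt
  | |- polytime (fun x => node_gate (@?f x) (@?g x)) =>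
      refine (pt_node_gate (C := f) (v := g) _ _); pt
  | |- polytime (fun x => in_nbrs (@?f x) (@?g x)) =>
      refine (pt_in_nbrs (C := f) (v := g) _ _); pt
  | |- polytime (fun x => large (@?f x) (@?g x)) =>
      refine (pt_large (C := f) (v := g) _ _); pt
  | |- polytime (fun x => nat_of_bool (@?f x)) =>
      refine (pt_nat_of_bool (f := f) _); pt
  | |- polytime (fun x => double (@?f x)) => refine (pt_double (f := f) _); pt
  | |- _ => idtac
  end.

Lemma pt_fan_in_ok A (cA : codable A) (g : A -> gate) :
  polytime g -> polytime (fun x => fan_in_ok (g x)).
Proof.
move=> pg; apply: (@pt_ext _ _ _ _ _ (fun x =>
  if conn_nat (g x).1 == 0 then size (g x).2 == 1 else 1 < size (g x).2)).
  by move=> x; rewrite /fan_in_ok; case: (g x) => -[].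
by pt.
Qed.

Lemma pt_well_formedb : polytime well_formedb.
Proof.
rewrite /well_formedb; pt; apply: pt_fan_in_ok; pt.
Qed.

(** The recursion is unfolded along the fixed [j]. The induction hypothesis ranges over all [A],
    because the recursive calls occur under [all], in a larger context. *)
Lemma pt_shallow j w A (cA : codable A) (C : A -> circuit) (v : A -> nat) :
  polytime C -> polytime v -> polytime (fun x => shallow (C x) j w (v x)).
Proof.
elim: j w A cA C v => [|j IH] w A cA C v pC pv; first by rewrite /=; pt.
apply: (@pt_ext _ _ _ _ _ _ (fun x => shallowS (C x) j w (v x))); pt;
  (refine (IH _ _ _ _ _ _ _); pt).
Qed.

Lemma pt_dnf j A (cA : codable A) (C : A -> circuit) (v : A -> nat) (b : A -> bool) :
  polytime C -> polytime v -> polytime b ->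
  polytime (fun x => dnf (C x) j (v x) (b x)).
Proof.
elim: j A cA C v b => [|j IH] A cA C v b pC pv pb; first by rewrite /=; pt.
rewrite /= /disjunctive; pt; (refine (IH _ _ _ _ _ _ _ _); pt).
Qed.

Lemma pt_refutations d A (cA : codable A) (C : A -> circuit)
    (c : A -> seq (nat * bool)) :
  polytime C -> polytime c -> polytime (fun x => refutations (C x) d (c x)).
Proof.
by move=> pC pc; rewrite /refutations; pt; apply: pt_dnf; pt.
Qed.

Lemma pt_words q A T (cA : codable A) (cT : codable T) (s : A -> seq T) :
  polytime s -> polytime (fun x => words q (s x)).
Proof.
move=> ps; elim: q => [|q IH]; first exact: pt_const.
by rewrite /=; apply: pt_allpairs => //; pt.
Qed.

Lemma pt_output : polytime output.
Proof. by rewrite /output /nodes; pt. Qed.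

Lemma pt_items d : polytime (fun y : circuit * nat => items d y.1 y.2).
Proof.
have po := pt_output.
have pD : polytime (fun C => dnf C d (output C) true) by apply: pt_dnf; pt.
have pU : polytime (fun y : circuit * item => unrefuted d y.1 y.2).
  rewrite /unrefuted /true_in; pt; apply: pt_refutations; pt.
  by apply: (pt_comp pD); pt.
have pG : polytime (fun y : circuit * nat => gaps y.2 (inputs y.1)).
  by rewrite /gaps /gap_ok; pt.
rewrite /items; pt.
- by apply: (pt_comp pU (f := fun y : circuit * nat * item => (y.1.1, y.2))); pt.
- by apply: (pt_comp pD); pt.
- by apply: pt_words; apply: (pt_comp pG (f := fun y : circuit * nat => y)); pt.
Qed.

Lemma pt_enc_vertices :
  polytime (enc_vertices item_colour item_view).
Proof.
have pV : polytime item_view by rewrite /item_view; pt.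
have pa : polytime (fun u : vertex item * vertex item =>
    adjacent item_colour item_view u.1 u.2).
  by rewrite /adjacent /near /conflict /item_colour; pt.
have pn : polytime enc_nat by apply: (pt_enc_nat (pt_id _)).
rewrite /enc_vertices; pt; by apply: (pt_comp pa (f := snd)); pt.
Qed.

Lemma pt_valid d : polytime (valid d).
Proof.
have pp := pt_parse; have pe := pt_enc_circuit; have pw := pt_well_formedb.
have po := pt_output.
by rewrite /valid; pt; apply: pt_shallow; pt.
Qed.

Lemma pt_reduction d : polytime (reduction d).
Proof.
have pp := pt_parse; have pv := pt_valid d; have pe := pt_enc_vertices.
rewrite /reduction /vertices; pt.
by apply: (pt_comp (pt_items d) (f := fun y : seq bool * nat => (parse y.1, y.2))); pt.
Qed.

(** * Composition of fpt-reductions with polynomial-time reductions *)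

Lemma computable_comp (f h : nat -> nat) :
  computable f -> polytime h -> computable (fun n => h (f n)).
Proof.
move=> [p Hp] [q [l [_ Hq]]]; exists (Seq p (q 0)) => n.
have [t [s1 ex1 r1]] := Hp n; have [s2 [t2 [ex2 r2 _ _]]] := Hq 0 s1 (f n) r1.
by exists (t + t2), s2 => //; apply: ExecSeq ex1 ex2.
Qed.

Lemma tsize_instance x k :
  tsize (tree_of_instance x k) <= 4 * (size x + k).+1.
Proof.
have lex : tsize (tree_of_bits x) <= 4 * size x + 1.
  by elim: x => //= -[] x IH /=; lia.
have := csize_nat k; rewrite /csize /code /codable_nat /=; lia.
Qed.

(** The intermediate instance is at most as large as the input plus the time of the first reduction,
    so a polynomial in its size is still an fpt bound. Monotonicity of [g] carries the bound
    [k' <= g0 k] over to the new parameter. *)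
Lemma fpt_reducible_comp (P Q R : param_problem) (r : seq bool * nat -> seq bool * nat)
    (g : nat -> nat) :
  fpt_reducible P Q -> polytime r -> polytime g -> {homo g : m n / m <= n} ->
  (forall x k, (r (x, k)).2 <= g k) ->
  (forall x k, Q x k <-> R (r (x, k)).1 (r (x, k)).2) ->
  fpt_reducible P R.
Proof.
move=> [p [f [g0 [c [cf cg Hp]]]]] [q [h [[e He] Hq]]] pg g_mono r_le QR.
exists (Seq p (q 0)), (fun k => (f k + 8) ^ e.+2), (fun k => g (g0 k)), (c.+1 * e.+2).
split; [|exact: computable_comp|].
  by apply: (computable_comp (h := fun n => (n + 8) ^ e.+2)) => //; pt.
move=> x k; have [x' [k' [t [[s1 ex1 r1] le_t le_k PQ]]]] := Hp x k.
have [s2 [t2 [ex2 r2 _ le_t2]]] := Hq 0 s1 (x', k') r1.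
exists (r (x', k')).1, (r (x', k')).2, (t + t2); split.
- exists s2; first exact: ExecSeq ex1 ex2.
  by rewrite r2.
- pose n := (size x + k).+1; rewrite -/n in le_t *.
  have size_out : (csize (x', k')).+2 <= 4 * n + f k * n ^ c + 2.
    have le_out : csize (x', k') <= tsize (tree_of_instance x k) + t.
      by have := exec_size 0 ex1; rewrite r1 /init_store update_eq.
    have le_in := tsize_instance x k; rewrite -/n in le_in.
    by move: le_out le_in le_t; move: (tsize _) (csize _) (f k * _); lia.
  (* [X] bounds both the time [t] of the first program and the size of the intermediate instance.
     The total is then at most [X + X ^ e <= X ^ e.+2], which explains the exponents chosen
     above. *)
  pose X := (f k + 8) * n ^ c.+1.
  have n_gt0 : 0 < n by [].
  have nc_gt0 : 0 < n ^ c by rewrite expn_gt0.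
  have X_ge : 4 * n + f k * n ^ c + 2 <= X.
    rewrite /X expnS; nia.
  have le2 : t2 <= X ^ e.
    apply: leq_trans le_t2 _; apply: leq_trans (He _) _.
    by case: (e) => // e'; rewrite leq_exp2r // (leq_trans size_out X_ge).
  have le1 : t <= X by apply: leq_trans X_ge; lia.
  rewrite mulnC expnM mulnC -expnMn -/X !expnS.
  have X_gt1 : 1 < X by lia.
  have Y_gt0 : 0 < X ^ e by rewrite expn_gt0; lia.
  apply: (@leq_trans (X * X ^ e + X * X ^ e)).
    apply: leq_add; first by apply: leq_trans le1 _; rewrite leq_pmulr.
    by apply: leq_trans le2 _; rewrite leq_pmull // ltnW.
  by rewrite addnn -mul2n leq_mul2r X_gt1 orbT.
- by apply: leq_trans (r_le _ _) _; apply: g_mono.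
- by rewrite PQ.
Qed.

Theorem theorem3 : W_hard 1 one_sided_grundy_total_domination.
Proof.
move=> P [d _ redP].
(* The depth [d] comes with [P] and is a constant of the reduction, so [g] is a polynomial. *)
pose g k := k.+1 ^ (2 ^ d) * (k.+3).*2.+1.
apply: (fpt_reducible_comp (r := reduction d) (g := g) redP).
- exact: pt_reduction.
- by rewrite /g; pt.
- move=> m n le_mn; apply: leq_mul; last by rewrite ltnS leq_double.
  by rewrite leq_exp2r ?expn_gt0.
- by [].
- exact: reduction_correct.
Qed.
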